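(* Let $\Bbbk$ be a commutative ring with unit and let $A$ be a $\Bbbk$-superalgebra whose underlying $\Bbbk$-module is finitely generated and free. Let $m,n,d$ be positive integers with $m\ge d$ and $n\ge d$. Then there are equivalences of categories (i) $\boldsymbol{\mathcal P}_{d,\boldsymbol{\mathcal V}_A}\ \xrightarrow{\ \sim\ }\ S^A(m|n,d)\text{-}\mathbf{mod}$, given by evaluation $F\mapsto F(A^{m|n})$; (ii) $\boldsymbol{\mathcal P}_{d,\boldsymbol{\mathcal E}_A}\ \xrightarrow{\ \sim\ }\ S^A(n,d)\text{-}\mathbf{mod}$, given by evaluation $F\mapsto F(A^{n})$.
   Context: **Supermodules.** A $\Bbbk$-supermodule is a $\mathbb Z/2$-graded $\Bbbk$-module $M=M_{\bar 0}\oplus M_{\bar 1}$; $\overline v$ is the parity of a homogeneous $v$. Tensor products (over $\Bbbk$) and $\mathrm{Hom}$ (all $\Bbbk$-linear maps) carry the usual $\mathbb Z/2$-gradings; even maps preserve parity. Formulas with signs are stated for homogeneous elements and extended linearly. $\boldsymbol{\mathcal V}_\Bbbk$ is the category of finitely generated projective $\Bbbk$-supermodules with all $\Bbbk$-linear maps. A superalgebra is a $\Bbbk$-supermodule with a unital associative $\Bbbk$-algebra structure whose multiplication $A\otimes A\to A$ is even. **Supermodules over a superalgebra.** A left (right) $A$-supermodule is a $\Bbbk$-supermodule that is a left (right) $A$-module with action compatible with the gradings. Homomorphisms are (not necessarily homogeneous) $\Bbbk$-linear maps with $\varphi(av)=(-1)^{\overline\varphi\,\overline a}a\varphi(v)$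 for left supermodules, and $\varphi(va)=\varphi(v)a$ for right supermodules; $\mathrm{Hom}_A(M,N)$ denotes the $\Bbbk$-supermodule of these and $\mathrm{End}_A(M)=\mathrm{Hom}_A(M,M)$. For a superalgebra $S$, $S\text{-}\mathbf{mod}$ denotes the category of left $S$-supermodules which are finitely generated as ordinary $S$-modules, with all (not necessarily even) homomorphisms. $\Pi M$ is $M$ with opposite grading, and $A^{m|n}:=A^m\oplus(\Pi A)^n$ as a right $A$-supermodule. A right $A$-supermodule is projective if it is a projective object of the abelian category of right $A$-supermodules and even homomorphisms. $\boldsymbol{\mathcal V}_A$ is the category of finitely generated projective right $A$-supermodules with all homomorphisms, and $\boldsymbol{\mathcal E}_A\subset\boldsymbol{\mathcal V}_A$ is the full subcategory of those $M$ that are evenly generated, i.e. admit an even surjective homomorphism $A^k\twoheadrightarrow M$ for some $k$. **Divided powers.** For $M\in \boldsymbol{\mathcal V}_\Bbbk$, $\mathfrak S_d$ acts on the right on $M^{\otimes d}$ with $(v_1\otimes\cdots\otimes v_d).(i\ i{+}1)=(-1)^{\overline v_i\overline v_{i+1}}v_1\otimes\cdots\otimes v_{i+1}\otimes v_i\otimes\cdots\otimes v_d$; put $\Gamma^dM:=(M^{\otimes d})^{\mathfrak S_d}$. For an even map $f:M\to N$, $\Gamma^d(f)$ is the restriction of $f^{\otimes d}$. The map $\psi^d:\Gamma^dM\otimes\Gamma^dN\to\Gamma^d(M\otimes N)$ is the restriction of the canonical isomorphism $M^{\otimes d}\otimes N^{\otimes d}\cong(M\otimes N)^{\otimes d}$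 built from supertwists $v\otimes w\mapsto(-1)^{\overline v\,\overline w}w\otimes v$. **The category $\Gamma^d\mathcal C$.** Let $\mathcal C$ be a category whose hom-sets are objects of $\boldsymbol{\mathcal V}_\Bbbk$ and whose composition is $\Bbbk$-bilinear and induces even maps $\mathrm{Hom}_{\mathcal C}(Y,Z)\otimes\mathrm{Hom}_{\mathcal C}(X,Y)\to\mathrm{Hom}_{\mathcal C}(X,Z)$. The category $\Gamma^d\mathcal C$ has the same objects as $\mathcal C$, $\mathrm{Hom}_{\Gamma^d\mathcal C}(X,Y):=\Gamma^d\mathrm{Hom}_{\mathcal C}(X,Y)$, and composition given by $\psi^d$ followed by $\Gamma^d$ of the composition map of $\mathcal C$. Similarly, for a superalgebra $B\in\boldsymbol{\mathcal V}_\Bbbk$, $\Gamma^dB$ is a subsuperalgebra of $B^{\otimes d}$ (the multiplication on $B^{\otimes d}$ uses the rule of signs $(a_1\otimes b_1)(a_2\otimes b_2)=(-1)^{\overline{b_1}\,\overline{a_2}}a_1a_2\otimes b_1b_2$). **Generalized polynomial functors.** $\boldsymbol{\mathcal P}_{d,\mathcal C}$ is the category of functors $F:\Gamma^d\mathcal C\to\boldsymbol{\mathcal V}_\Bbbk$ that are even and $\Bbbk$-linear on hom-supermodules. Morphisms $\eta:F\to G$ are families $\eta(X)=\eta_{\bar 0}(X)+\eta_{\bar 1}(X)\in\mathrm{Hom}(F(X),G(X))$, with $\eta_\epsilon(X)$ of parity $\epsilon$, such that $G(\varphi)\circ\eta_\epsilon(X)=(-1)^{\overline\varphi\,\epsilon}\eta_\epsilon(Y)\circ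 F(\varphi)$ for all homogeneous $\varphi:X\to Y$ in $\Gamma^d\mathcal C$. **Schur superalgebras.** $S^A(m|n,d):=\Gamma^d\,\mathrm{End}_A(A^{m|n})$ and $S^A(n,d):=\Gamma^d\,\mathrm{End}_A(A^n)$. These are the endomorphism superalgebras of $A^{m|n}$ in $\Gamma^d\boldsymbol{\mathcal V}_A$ and of $A^n$ in $\Gamma^d\boldsymbol{\mathcal E}_A$, and they act on $F(A^{m|n})$, resp. $F(A^n)$, through $F$.
   Formalization: For a general ring k, S-mod is replaced in (i) and (ii) by its full subcategory of supermodules that are finitely generated projective over k (for k = A = Z, d = 1, the printed claim fails on Z/2-modules); when k is a field, the statement with the full S-mod is also proved. *)

(* Defs.v *)
From HB Require Import structures.
From mathcomp Require Import all_boot all_algebra perm.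
From mathcomp Require Import boolp functions.
From mathcomp Require Import zify.

Set Implicit Arguments.
Unset Strict Implicit.
Unset Printing Implicit Defensive.
Import GRing.Theory.
Local Open Scope quotient_scope.
Local Open Scope ring_scope.

Section LinearFacts.
Variables (k : comPzRingType) (M N : lmodType k) (f : M -> N).
Hypothesis lf : linear f.

Lemma lin0 : f 0 = 0.
Proof. by have := lf (-1) 0 0; rewrite scaler0 addr0 scaleN1r addNr. Qed.
Lemma linD u v : f (u + v) = f u + f v.
Proof. by have := lf 1 u v; rewrite !scale1r. Qed.
Lemma linZ c u : f (c *: u) = c *: f u.
Proof. by have := lf c u 0; rewrite !addr0 lin0 addr0. Qed.
Lemma lin_sum (I : Type) (r : seq I) (P : pred I) (E : I -> M) :
  f (\sum_(i <- r | P i) E i) = \sum_(i <- r | P i) f (E i).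
Proof. exact: (big_morph f linD lin0). Qed.
End LinearFacts.

Lemma lin_comp (k : comPzRingType) (M N P : lmodType k) (g : N -> P) (f : M -> N) :
  linear g -> linear f -> linear (g \o f).
Proof. by move=> lg lf c u v; rewrite /= lf lg. Qed.

Section SubModule.
Variables (k : comPzRingType) (V : lmodType k).

Definition lsub (P : V -> Prop) :=
  P 0 /\ forall (c : k) (u v : V), P u -> P v -> P (c *: u + v).

Section Sub.
Variable P : V -> Prop.

Record lsubmod (HP : lsub P) := LSubmod { lval : V; lvalP : `[< P lval >] }.

Variable HP : lsub P.
HB.instance Definition _ := [isSub for @lval HP].
HB.instance Definition _ := [Choice of lsubmod HP by <:].

Fact lsub_closed : subsemimod_closed (fun x : V => `[< P x >]).
Proof.
case: HP => P0 PD; apply: GRing.submod_closed_semi; split.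
  exact: (introT (asboolP (P 0)) P0).
by move=> c u v /asboolP Pu /asboolP Pv; apply/asboolP; exact: PD.
Qed.
HB.instance Definition _ :=
  GRing.SubChoice_isSubLmodule.Build k V (fun x : V => `[< P x >])
    (lsubmod HP) lsub_closed.

Definition lsubm (x : V) (Px : P x) : lsubmod HP :=
  @LSubmod HP x (introT (asboolP _) Px).

Lemma lvalPP (x : lsubmod HP) : P (lval x).
Proof. exact: (elimT (asboolP _) (lvalP x)). Qed.
Lemma lval_inj (x y : lsubmod HP) : lval x = lval y -> x = y.
Proof. exact: val_inj. Qed.
Lemma lval_linear : linear (@lval HP).
Proof. by []. Qed.
End Sub.
End SubModule.

Section TensorPower.
Variables (k : comPzRingType) (d : nat) (M : lmodType k).

Definition tupd (v : {ffun 'I_d -> M}) (i : 'I_d) (x : M) : {ffun 'I_d -> M} :=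
  [ffun j => if j == i then x else v j].

Definition multilinear (N : lmodType k) (f : {ffun 'I_d -> M} -> N) : Prop :=
  forall v i, linear (fun x => f (tupd v i x)).

Definition tsum := seq (k * {ffun 'I_d -> M}).

Definition tev (N : lmodType k) (f : {ffun 'I_d -> M} -> N) (s : tsum) : N :=
  \sum_(p <- s) p.1 *: f p.2.

(* Formal linear combinations of d-tuples are identified when no multilinear
   map separates them, that is when their difference is a combination of the
   multilinearity relations; the quotient is the d-th tensor power of M. *)
Definition teq (s t : tsum) : Prop :=
  forall (N : lmodType k) (f : {ffun 'I_d -> M} -> N),
    multilinear f -> tev f s = tev f t.

Definition teqb (s t : tsum) : bool := `[< teq s t >].

Fact teqb_refl : reflexive teqb.
Proof. by move=> s; apply/asboolP. Qed.
Fact teqb_sym : symmetric teqb.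
Proof. by move=> s t; apply/asboolP/asboolP => h N f /h ->. Qed.
Fact teqb_trans : transitive teqb.
Proof.
by move=> t s u /asboolP h1 /asboolP h2; apply/asboolP => N f mf; rewrite h1 ?h2.
Qed.
Canonical teq_equiv := EquivRel teqb teqb_refl teqb_sym teqb_trans.

Definition tpow := {eq_quot teqb}.
HB.instance Definition _ := Choice.on tpow.
HB.instance Definition _ := EqQuotient.on tpow.

Definition tlift (N : lmodType k) (f : {ffun 'I_d -> M} -> N) (x : tpow) : N :=
  tev f (repr x).

Lemma tlift_pi (N : lmodType k) (f : {ffun 'I_d -> M} -> N) s :
  multilinear f -> tlift f (\pi_tpow s) = tev f s.
Proof.
move=> mf; rewrite /tlift.
have /eqmodP/asboolP : repr (\pi_tpow s) = s %[mod tpow] by rewrite reprK.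
exact.
Qed.

Lemma tpow_eqP (x y : tpow) :
  (forall (N : lmodType k) (f : {ffun 'I_d -> M} -> N),
    multilinear f -> tlift f x = tlift f y) -> x = y.
Proof.
move=> h; rewrite -[x]reprK -[y]reprK; apply/eqmodP/asboolP => N f mf.
exact: h.
Qed.

Definition tadd (x y : tpow) : tpow := \pi_tpow (repr x ++ repr y : tsum).
Definition tscale (c : k) (x : tpow) : tpow :=
  \pi_tpow ([seq (c * p.1, p.2) | p <- repr x] : tsum).
Definition tzero : tpow := \pi_tpow ([::] : tsum).
Definition topp (x : tpow) : tpow := tscale (-1) x.

Section Ev.
Variables (N : lmodType k) (f : {ffun 'I_d -> M} -> N).
Hypothesis mf : multilinear f.
Lemma tlift_add x y : tlift f (tadd x y) = tlift f x + tlift f y.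
Proof. by rewrite tlift_pi // /tev big_cat. Qed.
Lemma tlift_scale c x : tlift f (tscale c x) = c *: tlift f x.
Proof.
rewrite tlift_pi // /tev big_map scaler_sumr.
by apply: eq_bigr => p _; rewrite scalerA.
Qed.
Lemma tlift_zero : tlift f tzero = 0.
Proof. by rewrite tlift_pi // /tev big_nil. Qed.
Lemma tlift_opp x : tlift f (topp x) = - tlift f x.
Proof. by rewrite tlift_scale scaleN1r. Qed.
Definition tliftE := (tlift_opp, tlift_zero, tlift_scale, tlift_add).
End Ev.

Fact taddA : associative tadd.
Proof. by move=> x y z; apply: tpow_eqP => N f mf; rewrite !tliftE // addrA. Qed.
Fact taddC : commutative tadd.
Proof. by move=> x y; apply: tpow_eqP => N f mf; rewrite !tliftE // addrC. Qed.
Fact tadd0 : left_id tzero tadd.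
Proof. by move=> x; apply: tpow_eqP => N f mf; rewrite !tliftE // add0r. Qed.
Fact taddN : left_inverse tzero topp tadd.
Proof. by move=> x; apply: tpow_eqP => N f mf; rewrite !tliftE // addNr. Qed.
HB.instance Definition _ := GRing.isZmodule.Build tpow taddA taddC tadd0 taddN.

Fact tscaleA a b v : tscale a (tscale b v) = tscale (a * b) v.
Proof. by apply: tpow_eqP => N f mf; rewrite !tliftE // scalerA. Qed.
Fact tscale1 : left_id 1 tscale.
Proof. by move=> v; apply: tpow_eqP => N f mf; rewrite !tliftE // scale1r. Qed.
Fact tscaleDr : right_distributive tscale tadd.
Proof. by move=> c x y; apply: tpow_eqP => N f mf; rewrite !tliftE // scalerDr. Qed.
Fact tscaleDl v : {morph tscale^~ v : a b / a + b >-> tadd a b}.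
Proof. by move=> a b; apply: tpow_eqP => N f mf; rewrite !tliftE // scalerDl. Qed.
HB.instance Definition _ := GRing.Zmodule_isLmodule.Build k tpow
  tscaleA tscale1 tscaleDr tscaleDl.

Definition pure (v : {ffun 'I_d -> M}) : tpow := \pi_tpow ([:: (1, v)] : tsum).

Lemma tlift_linear (N : lmodType k) (f : {ffun 'I_d -> M} -> N) :
  multilinear f -> linear (tlift f).
Proof.
by move=> mf c u v; rewrite (tlift_add mf) (tlift_scale mf).
Qed.

Lemma tlift_pure (N : lmodType k) (f : {ffun 'I_d -> M} -> N) v :
  multilinear f -> tlift f (pure v) = f v.
Proof. by move=> mf; rewrite tlift_pi // /tev big_seq1 scale1r. Qed.

Lemma pure_multilinear : multilinear pure.
Proof.
move=> v i c x y; apply: tpow_eqP => N f mf.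
rewrite (tlift_add mf) (tlift_scale mf) !tlift_pure //; exact: mf.
Qed.

Lemma pure_span (x : tpow) : x = \sum_(p <- repr x) p.1 *: pure p.2.
Proof.
apply: tpow_eqP => N f mf; rewrite (lin_sum (tlift_linear mf)).
rewrite {1}/tlift /tev; apply: eq_bigr => p _.
by rewrite (linZ (tlift_linear mf)) tlift_pure.
Qed.

Lemma tpow_ext (N : lmodType k) (f g : tpow -> N) :
  linear f -> linear g -> (forall v, f (pure v) = g (pure v)) -> f =1 g.
Proof.
move=> lf lg e x; rewrite (pure_span x) (lin_sum lf) (lin_sum lg).
by apply: eq_bigr => p _; rewrite (linZ lf) (linZ lg) e.
Qed.
End TensorPower.

(* The grading is given by its two projections [par false] (onto the even
   part) and [par true] (onto the odd part). *)
Record supermod (k : comPzRingType) := Supermod {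
  sm_mod :> lmodType k;
  par : bool -> sm_mod -> sm_mod;
  par_lin : forall a, linear (par a);
  par_par : forall a b v, par a (par b v) = if a == b then par b v else 0;
  par_sum : forall v, par false v + par true v = v }.

Definition homog (k : comPzRingType) (M : supermod k) (a : bool) (v : M) : Prop :=
  par a v = v.

Section SuperFacts.
Variables (k : comPzRingType) (M : supermod k).

Lemma par_homog a (v : M) : homog a (par a v).
Proof. by rewrite /homog par_par eqxx. Qed.
Lemma homogE a b (v : M) : homog a v -> par b v = if b == a then v else 0.
Proof. by move=> h; rewrite -{1}h par_par; case: eqP => // _; rewrite h. Qed.
Lemma homog_sub a : lsub (@homog k M a).
Proof.
split; first exact: (lin0 (par_lin a)).
by move=> c u v hu hv; rewrite /homog (par_lin a) hu hv.
Qed.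
Lemma homog0 a : homog a (0 : M).
Proof. exact: (homog_sub a).1. Qed.
Lemma homogZ a c (v : M) : homog a v -> homog a (c *: v).
Proof. by move=> h; rewrite /homog (linZ (par_lin a)) h. Qed.
Lemma homogD a (u v : M) : homog a u -> homog a v -> homog a (u + v).
Proof. by move=> hu hv; rewrite /homog (linD (par_lin a)) hu hv. Qed.

Lemma super_ext (N : lmodType k) (f g : M -> N) :
  linear f -> linear g -> (forall a v, homog a v -> f v = g v) -> f =1 g.
Proof.
move=> lf lg e v; rewrite -(par_sum v) (linD lf) (linD lg).
by rewrite (e false) ?(e true) //; exact: par_homog.
Qed.
End SuperFacts.

(* The parity of the sum of e_i * e'_j over the pairs j < i. *)
Definition koszul (d : nat) (e e' : {ffun 'I_d -> bool}) : bool :=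
  \big[addb/false]_(i < d) \big[addb/false]_(j < d | (j < i)%N) (e i && e' j).

Definition parity (d : nat) (e : {ffun 'I_d -> bool}) : bool :=
  \big[addb/false]_(i < d) e i.

Section MultilinearFacts.
Variables (k : comPzRingType) (d : nat).
Implicit Types (M N : lmodType k).

Lemma tupd_id M (v : {ffun 'I_d -> M}) i : tupd v i (v i) = v.
Proof. by apply/ffunP => j; rewrite ffunE; case: eqP => // ->. Qed.

Lemma multilinear0 M N (f : {ffun 'I_d -> M} -> N) (v : {ffun 'I_d -> M}) i :
  multilinear f -> v i = 0 -> f v = 0.
Proof. by move=> mf vi; rewrite -(tupd_id v i) vi (lin0 (mf v i)). Qed.

Lemma multilinear_sum M N (I : finType) (f : I -> {ffun 'I_d -> M} -> N) :
  (forall j, multilinear (f j)) -> multilinear (fun v => \sum_j f j v).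
Proof.
move=> mf v i c x y /=; rewrite scaler_sumr -big_split /=.
by apply: eq_bigr => j _; exact: mf.
Qed.

Lemma multilinearZ M N (f : {ffun 'I_d -> M} -> N) a :
  multilinear f -> multilinear (fun v => a *: f v).
Proof.
move=> mf v i c x y /=; rewrite (mf v i c x y) scalerDr !scalerA.
by rewrite [a * c]mulrC.
Qed.

Lemma multilinear_cst0 M N : multilinear (fun _ : {ffun 'I_d -> M} => 0 : N).
Proof. by move=> v i c x y; rewrite scaler0 addr0. Qed.

Lemma multilinear_perm M (s : 'I_d -> 'I_d) : involutive s ->
  multilinear (fun v : {ffun 'I_d -> M} => pure [ffun l => v (s l)]).
Proof.
move=> sK v i c x y /=.
suff E z : [ffun l => tupd v i z (s l)] = tupd [ffun l => v (s l)] (s i) z.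
  by rewrite !E; exact: pure_multilinear.
apply/ffunP => l; rewrite !ffunE.
by rewrite (can2_eq sK sK).
Qed.

Lemma multilinear_comp M N (P : lmodType k) (f : {ffun 'I_d -> M} -> N)
  (h : N -> P) : linear h -> multilinear f -> multilinear (h \o f).
Proof. by move=> lh mf v i; apply: lin_comp lh (mf v i). Qed.
End MultilinearFacts.

Section SuperExt.
Variables (k : comPzRingType) (d : nat) (M : supermod k).

Definition parts (e : {ffun 'I_d -> bool}) (v : {ffun 'I_d -> M}) :
  {ffun 'I_d -> M} := [ffun i => par (e i) (v i)].

(* The multilinear extension of a formula [c e v] stated for tuples v of
   homogeneous elements of parities e. *)
Definition superext (N : lmodType k)
    (c : {ffun 'I_d -> bool} -> {ffun 'I_d -> M} -> N) (v : {ffun 'I_d -> M}) : N :=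
  \sum_e c e (parts e v).

Definition thomog (e : {ffun 'I_d -> bool}) (v : {ffun 'I_d -> M}) : Prop :=
  forall i, homog (e i) (v i).

Lemma superext_multilinear (N : lmodType k)
    (c : {ffun 'I_d -> bool} -> {ffun 'I_d -> M} -> N) :
  (forall e, multilinear (c e)) -> multilinear (superext c).
Proof.
move=> mc; apply: (@multilinear_sum k d M N _ (fun e v => c e (parts e v))) => e.
move=> v i a x y /=.
suff E z : parts e (tupd v i z) = tupd (parts e v) i (par (e i) z).
  by rewrite !E (par_lin (e i)) (mc e (parts e v) i).
by apply/ffunP => j; rewrite !ffunE; case: eqP => // ->.
Qed.

Lemma superext_homog (N : lmodType k)
    (c : {ffun 'I_d -> bool} -> {ffun 'I_d -> M} -> N) e v :
  (forall e, multilinear (c e)) -> thomog e v -> superext c v = c e v.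
Proof.
move=> mc hv; rewrite /superext (bigD1 e) //= big1 ?addr0.
  by congr (c e _); apply/ffunP => i; rewrite ffunE; exact: hv.
move=> e' /eqP ne; have [i /eqP nei] : exists i, e' i != e i.
  apply/existsP; rewrite -negb_forall; apply/negP => /forallP h; apply: ne.
  by apply/ffunP => i; exact/eqP.
apply: (multilinear0 (i := i)) => //.
by rewrite ffunE (homogE _ (hv i)); case: eqP.
Qed.

Lemma tpow_exth (N : lmodType k) (f g : tpow d M -> N) :
  linear f -> linear g ->
  (forall e v, thomog e v -> f (pure v) = g (pure v)) -> f =1 g.
Proof.
move=> lf lg H; apply: tpow_ext => // v.
suff S (l : seq 'I_d) : forall v : {ffun 'I_d -> M},
    (forall i, i \in l \/ exists a, homog a (v i)) -> f (pure v) = g (pure v).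
  by apply: (S (enum 'I_d)) => i; left; rewrite mem_enum.
elim: l => [|i l IH] {}v hv.
  apply: (H [ffun i => par true (v i) == v i]) => i; rewrite ffunE.
  case: (hv i) => // -[a ha]; rewrite (homogE true ha).
  case: a ha => //= ha; rewrite ?eqxx //.
  by case: eqP => // <-; exact: homog0.
have E : pure v = 1 *: pure (tupd v i (par false (v i)))
                  + pure (tupd v i (par true (v i))).
  rewrite -(pure_multilinear v i) scale1r par_sum tupd_id //.
rewrite E lf lg; congr (_ *: _ + _); apply: IH => j;
  rewrite ffunE; case: eqP => [ji|/eqP ji]; try (right; eexists; exact: par_homog);
  by case: (hv j); [rewrite inE (negPf ji); left | right].
Qed.
End SuperExt.

Section TensorSuper.
Variables (k : comPzRingType) (d : nat) (M : supermod k).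

Definition tpar (a : bool) : tpow d M -> tpow d M :=
  tlift (superext (fun (e : {ffun 'I_d -> bool}) v =>
    if a == parity e then pure v else 0)).

Fact tpar_mlin a (e : {ffun 'I_d -> bool}) :
  multilinear (fun v : {ffun 'I_d -> M} => if a == parity e then pure v else 0).
Proof.
by case: eqP => _; [exact: pure_multilinear | exact: multilinear_cst0].
Qed.

Lemma tpar_lin a : linear (tpar a).
Proof. exact: tlift_linear (superext_multilinear (tpar_mlin a)). Qed.

Lemma tpar_pure a e v :
  thomog e v -> tpar a (pure v) = if a == parity e then pure v else 0.
Proof.
move=> hv; rewrite /tpar tlift_pure; last exact: superext_multilinear (tpar_mlin a).
by rewrite (superext_homog (tpar_mlin a) hv).
Qed.

Lemma tpar_par a b x : tpar a (tpar b x) = if a == b then tpar b x else 0.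
Proof.
pose h x := if a == b then tpar b x else 0.
have lh : linear h.
  by rewrite /h; case: eqP => _; [exact: tpar_lin | move=> c u v /=; rewrite scaler0 addr0].
apply: (tpow_exth (g := h) (lin_comp (tpar_lin a) (tpar_lin b)) lh) => e v hv.
rewrite /h /= (tpar_pure _ hv); case: (b =P parity e) => [->|_].
  by rewrite (tpar_pure _ hv).
by rewrite (lin0 (tpar_lin a)); case: ifP.
Qed.

Lemma tpar_sum x : tpar false x + tpar true x = x.
Proof.
have l1 : linear (fun x => tpar false x + tpar true x).
  move=> c u v; rewrite !(tpar_lin _ c u v) scalerDr.
  by rewrite addrACA.
apply: (tpow_exth l1 (g := id)) => // e v hv.
by rewrite !(tpar_pure _ hv); case: (parity e); rewrite ?addr0 ?add0r.
Qed.

Definition tpow_super : supermod k :=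
  @Supermod k (tpow d M) tpar tpar_lin tpar_par tpar_sum.

(* This is the action of the transposition (i j) only when i and j are adjacent:
   otherwise the sign would also involve the entries in between. *)
Definition tswap (i j : 'I_d) : tpow d M -> tpow d M :=
  tlift (superext (fun (e : {ffun 'I_d -> bool}) v =>
    (-1) ^+ (e i && e j) *: pure [ffun l => v (tperm i j l)])).

Fact tswap_mlin i j (e : {ffun 'I_d -> bool}) : multilinear
  (fun v : {ffun 'I_d -> M} => (-1) ^+ (e i && e j) *: pure [ffun l => v (tperm i j l)]).
Proof. by apply: multilinearZ; apply: multilinear_perm; exact: tpermK. Qed.

Lemma tswap_lin i j : linear (tswap i j).
Proof. exact: tlift_linear (superext_multilinear (tswap_mlin i j)). Qed.

Lemma tswap_pure i j e v : thomog e v ->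
  tswap i j (pure v) = (-1) ^+ (e i && e j) *: pure [ffun l => v (tperm i j l)].
Proof.
move=> hv; rewrite /tswap tlift_pure; last exact: superext_multilinear (tswap_mlin i j).
by rewrite (superext_homog (tswap_mlin i j) hv).
Qed.

Lemma thomog_perm (s : 'I_d -> 'I_d) e v : thomog e v ->
  thomog [ffun l => e (s l)] [ffun l => v (s l) : M].
Proof. by move=> hv l; rewrite !ffunE; exact: hv. Qed.

Lemma parity_perm i j (e : {ffun 'I_d -> bool}) :
  parity [ffun l => e (tperm i j l)] = parity e.
Proof.
rewrite /parity [RHS](reindex_inj (@perm_inj _ (tperm i j))).
by apply: eq_bigr => l _; rewrite ffunE.
Qed.

Lemma tswap_par a i j x : tpar a (tswap i j x) = tswap i j (tpar a x).
Proof.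
apply: (tpow_exth (lin_comp (tpar_lin a) (tswap_lin i j))
                  (lin_comp (tswap_lin i j) (tpar_lin a))) => e v hv /=.
rewrite (tpar_pure _ hv) (tswap_pure _ _ hv) (linZ (tpar_lin a)).
rewrite (tpar_pure _ (thomog_perm _ hv)) parity_perm.
case: eqP => _; first by rewrite (tswap_pure _ _ hv).
by rewrite scaler0 (lin0 (tswap_lin i j)).
Qed.

(* Being fixed by the adjacent transpositions amounts to being fixed by the
   whole symmetric group, which they generate. *)
Definition tinv (x : tpow d M) : Prop :=
  forall i j : 'I_d, j = i.+1 :> nat -> tswap i j x = x.

Lemma tinv_sub : lsub tinv.
Proof.
split=> [i j _|c u v iu iv i j ij]; first exact: (lin0 (tswap_lin i j)).
by rewrite (tswap_lin i j) (iu i j ij) (iv i j ij).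
Qed.
End TensorSuper.

Section SubSuper.
Variables (k : comPzRingType) (M : supermod k) (P : M -> Prop).
Hypothesis HP : lsub P.
Hypothesis Ppar : forall a v, P v -> P (par a v).

Definition subpar a (v : lsubmod HP) : lsubmod HP :=
  lsubm HP (Ppar a (lvalPP v)).
Fact subpar_lin a : linear (subpar a).
Proof. by move=> c u v; apply: lval_inj; exact: par_lin. Qed.
Fact subpar_par a b v : subpar a (subpar b v) = if a == b then subpar b v else 0.
Proof. by apply: lval_inj; rewrite /= par_par; case: eqP. Qed.
Fact subpar_sum v : subpar false v + subpar true v = v.
Proof. by apply: lval_inj; exact: par_sum. Qed.

Definition subsuper : supermod k :=
  @Supermod k (lsubmod HP) subpar subpar_lin subpar_par subpar_sum.
End SubSuper.

Fact tinv_par (k : comPzRingType) d (M : supermod k) a (x : tpow_super d M) :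
  tinv x -> tinv (par a x).
Proof. by move=> h i j ij; rewrite -tswap_par (h i j ij). Qed.

Definition divpow (k : comPzRingType) (d : nat) (M : supermod k) : supermod k :=
  @subsuper k (tpow_super d M) (@tinv k d M) (@tinv_sub k d M) (@tinv_par k d M).

Section Koszul.
Variable d : nat.
Implicit Types e f g : {ffun 'I_d -> bool}.

Lemma koszulE e f :
  koszul e f = \big[addb/false]_(i < d) \big[addb/false]_(j < d) ((j < i)%N && (e i && f j)).
Proof.
apply: eq_bigr => i _; rewrite big_mkcond; apply: eq_bigr => j _.
by case: (j < i)%N.
Qed.

Lemma koszulDl e f g :
  koszul [ffun i => e i (+) f i] g = koszul e g (+) koszul f g.
Proof.
rewrite !koszulE -big_split; apply: eq_bigr => i _ /=; rewrite -big_split /=.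
by apply: eq_bigr => j _; rewrite ffunE; case: (_ < _)%N; case: (e _); case: (f _); case: (g _).
Qed.

Lemma koszulDr e f g :
  koszul e [ffun i => f i (+) g i] = koszul e f (+) koszul e g.
Proof.
rewrite !koszulE -big_split; apply: eq_bigr => i _ /=; rewrite -big_split /=.
by apply: eq_bigr => j _; rewrite ffunE; case: (_ < _)%N; case: (e _); case: (f _); case: (g _).
Qed.

Lemma koszul0l f : koszul [ffun _ => false] f = false.
Proof.
by rewrite koszulE big1 // => i _; rewrite big1 // => j _; rewrite ffunE andbF.
Qed.
Lemma koszul0r f : koszul f [ffun _ => false] = false.
Proof.
by rewrite koszulE big1 // => i _; rewrite big1 // => j _; rewrite ffunE !andbF.
Qed.

Lemma pick_pair (X : 'I_d -> 'I_d -> bool) i j :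
  \big[addb/false]_a \big[addb/false]_b (((a == i) && (b == j)) && X a b) = X i j.
Proof.
rewrite (bigD1 i) //= (bigD1 j) //= !eqxx /= big1 ?addbF; last first.
  by move=> b /negPf ->.
by rewrite big1 ?addbF // => a /negPf -> ; rewrite big1.
Qed.

Lemma koszul_swap (i j : 'I_d) e f : j = i.+1 :> nat ->
  koszul [ffun l => e (tperm i j l)] [ffun l => f (tperm i j l)] =
  koszul e f (+) ((e i && f j) (+) (e j && f i)).
Proof.
move=> ij; set s := tperm i j.
have -> : koszul [ffun l => e (s l)] [ffun l => f (s l)] =
    \big[addb/false]_(a < d) \big[addb/false]_(b < d) ((s b < s a)%N && (e a && f b)).
  rewrite koszulE [RHS](reindex_inj (@perm_inj _ s)) /=; apply: eq_bigr => a _.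
  rewrite [RHS](reindex_inj (@perm_inj _ s)) /=; apply: eq_bigr => b _.
  by rewrite !ffunE !tpermK.
rewrite koszulE -(pick_pair (fun a b => e a && f b) i j).
rewrite -(pick_pair (fun a b => e a && f b) j i) -!big_split /=.
apply: eq_bigr => a _; rewrite -!big_split /=; apply: eq_bigr => b _.
have -> : (s b < s a)%N =
    (b < a)%N (+) (((a == i) && (b == j)) (+) ((a == j) && (b == i))).
  rewrite /s; have nij : (i == j) = false by apply/eqP => h; move: ij; rewrite h; lia.
  have vne (x y : 'I_d) : x != y -> (x : nat) <> y.
    by move=> /eqP h /val_inj.
  case: (tpermP i j a) => [->|->|/eqP/[dup]/vne ai /negPf -> /eqP/[dup]/vne aj /negPf ->];
  case: (tpermP i j b) => [->|->|/eqP/[dup]/vne bi /negPf -> /eqP/[dup]/vne bj /negPf ->];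
  rewrite ?eqxx ?[j == i]eq_sym ?nij ?(negPf bi) ?(negPf ai) /=; lia.
case: (b < a)%N; case: (a == i); case: (b == j); case: (a == j);
  by case: (b == i); case: (e a); case: (f b).
Qed.
End Koszul.

Section TensorProduct.
Variables (k : comPzRingType) (d : nat) (M N P : supermod k) (B : M -> N -> P).
Hypothesis Bl : forall f, linear (B^~ f).
Hypothesis Br : forall g, linear (B g).
Hypothesis Be : forall a b g f,
  homog a g -> homog b f -> homog (a (+) b) (B g f).

(* For an even bilinear map B from M and N to P, the bilinear map induced by
   the d-th tensor power of B after the isomorphism of the product of the d-th
   tensor powers of M and N with the d-th tensor power of their product.  The
   sign comes from moving each f_j past all g_i with j < i. *)
Definition tmul (x : tpow d M) (y : tpow d N) : tpow d P :=
  tlift (superext (fun (e : {ffun 'I_d -> bool}) g =>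
    tlift (superext (fun (e' : {ffun 'I_d -> bool}) f =>
      (-1) ^+ koszul e e' *: pure [ffun i => B (g i) (f i)])) y)) x.

Let core (e : {ffun 'I_d -> bool}) (g : {ffun 'I_d -> M}) (e' : {ffun 'I_d -> bool}) (f : {ffun 'I_d -> N}) : tpow d P :=
  (-1) ^+ koszul e e' *: pure [ffun i => B (g i) (f i)].

Lemma core_mlinr e g e' : multilinear (core e g e').
Proof.
apply: multilinearZ => v i c x y /=.
suff E z : [ffun l => B (g l) (tupd v i z l)] =
           tupd [ffun l => B (g l) (v l)] i (B (g i) z).
  by rewrite !E Br pure_multilinear.
by apply/ffunP => l; rewrite !ffunE; case: eqP => // ->.
Qed.

Lemma core_mlinl e e' f : multilinear (fun g => core e g e' f).
Proof.
apply: multilinearZ => v i c x y /=.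
suff E z : [ffun l => B (tupd v i z l) (f l)] =
           tupd [ffun l => B (v l) (f l)] i (B z (f i)).
  by rewrite !E Bl pure_multilinear.
by apply/ffunP => l; rewrite !ffunE; case: eqP => // ->.
Qed.

Let inner e g y := tlift (superext (core e g)) y.

Lemma inner_linr e g : linear (inner e g).
Proof. exact: tlift_linear (superext_multilinear (core_mlinr e g)). Qed.

Lemma inner_mlinl e y : multilinear (fun g => inner e g y).
Proof.
move=> v i c x z; rewrite /inner.
apply: (tpow_ext (f := fun y => tlift (superext (core e (tupd v i (c *: x + z)))) y)
  (g := fun y => c *: tlift (superext (core e (tupd v i x))) y +
                 tlift (superext (core e (tupd v i z))) y)).
- exact: inner_linr.
- move=> a u w; have L g : inner e g (a *: u + w) = a *: inner e g u + inner e g w.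
    exact: inner_linr.
  rewrite -!/(inner _ _ _) !L !scalerDr !scalerA [c * a]mulrC.
  by rewrite addrACA.
move=> f; rewrite !tlift_pure; try exact: superext_multilinear (core_mlinr _ _).
rewrite /superext scaler_sumr -big_split; apply: eq_bigr => e' _.
exact: (core_mlinl e e' (parts e' f)).
Qed.

Lemma tmul_linl y : linear (tmul^~ y).
Proof.
exact: tlift_linear (superext_multilinear (fun e => inner_mlinl e y)).
Qed.

Lemma tmul_linr x : linear (tmul x).
Proof.
move=> c y z.
apply: (tpow_ext (f := fun x => tmul x (c *: y + z))
  (g := fun x => c *: tmul x y + tmul x z)).
- exact: tmul_linl.
- move=> a u w; rewrite !(tmul_linl _ a u w) !scalerDr !scalerA [c * a]mulrC.
  by rewrite addrACA.
move=> g; rewrite /tmul !tlift_pure;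
  try exact: superext_multilinear (fun e => inner_mlinl e _).
rewrite /superext scaler_sumr -big_split; apply: eq_bigr => e _.
exact: inner_linr.
Qed.

Lemma tmul_pure (e : {ffun 'I_d -> bool}) g (e' : {ffun 'I_d -> bool}) f : thomog e g -> thomog e' f ->
  tmul (pure g) (pure f) = (-1) ^+ koszul e e' *: pure [ffun i => B (g i) (f i)].
Proof.
move=> hg hf; rewrite /tmul tlift_pure;
  last exact: superext_multilinear (fun e => inner_mlinl e _).
rewrite (superext_homog (fun e => inner_mlinl e _) hg).
rewrite /inner tlift_pure; last exact: superext_multilinear (core_mlinr _ _).
by rewrite (superext_homog (core_mlinr e g) hf).
Qed.

Lemma thomogB (e : {ffun 'I_d -> bool}) g (e' : {ffun 'I_d -> bool}) f : thomog e g -> thomog e' f ->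
  thomog [ffun i => e i (+) e' i] [ffun i => B (g i) (f i)].
Proof. by move=> hg hf i; rewrite !ffunE; exact: Be. Qed.

Lemma tmul_ext (Q : lmodType k) (h h' : tpow d M -> tpow d N -> Q) :
  (forall y, linear (h^~ y)) -> (forall x, linear (h x)) ->
  (forall y, linear (h'^~ y)) -> (forall x, linear (h' x)) ->
  (forall (e : {ffun 'I_d -> bool}) g (e' : {ffun 'I_d -> bool}) f, thomog e g -> thomog e' f ->
     h (pure g) (pure f) = h' (pure g) (pure f)) ->
  forall x y, h x y = h' x y.
Proof.
move=> hl hr hl' hr' E x y.
apply: (tpow_exth (f := h^~ y) (g := h'^~ y)) => // e g hg.
by apply: (tpow_exth (f := h _) (g := h' _)) => // e' f; exact: E hg.
Qed.

Lemma parityD (e e' : {ffun 'I_d -> bool}) :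
  parity [ffun i => e i (+) e' i] = parity e (+) parity e'.
Proof. by rewrite /parity -big_split; apply: eq_bigr => i _; rewrite ffunE. Qed.

Lemma tmul_even a b (x : tpow_super d M) (y : tpow_super d N) :
  homog a x -> homog b y -> homog (M := tpow_super d P) (a (+) b) (tmul x y).
Proof.
move=> <- <-; rewrite /homog /=.
have lt := @tpar_lin k d.
apply: (tmul_ext (h := fun x y => tpar (a (+) b) (tmul (tpar a x) (tpar b y)))
  (h' := fun x y => tmul (tpar a x) (tpar b y))).
- by move=> {}y c u v; rewrite lt tmul_linl lt.
- by move=> {}x c u v; rewrite lt tmul_linr lt.
- by move=> {}y c u v; rewrite lt tmul_linl.
- by move=> {}x c u v; rewrite lt tmul_linr.
move=> e g e' f hg hf; rewrite (tpar_pure _ hg) (tpar_pure _ hf).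
case: eqP => [->|_]; last first.
  by rewrite (lin0 (tmul_linl _)) (lin0 (lt _ _)).
case: eqP => [->|_]; last first.
  by rewrite (lin0 (tmul_linr _)) (lin0 (lt _ _)).
rewrite (tmul_pure hg hf) (linZ (lt _ _)) (tpar_pure _ (thomogB hg hf)).
by rewrite parityD eqxx.
Qed.

Lemma tmul_swap (i j : 'I_d) (x : tpow d M) (y : tpow d N) : j = i.+1 :> nat ->
  tmul (tswap i j x) (tswap i j y) = tswap i j (tmul x y).
Proof.
move=> ij; have lt := @tswap_lin k d.
apply: (tmul_ext (h := fun x y => tmul (tswap i j x) (tswap i j y))
  (h' := fun x y => tswap i j (tmul x y))).
- by move=> {}y c u v; rewrite lt tmul_linl.
- by move=> {}x c u v; rewrite lt tmul_linr.
- by move=> {}y c u v; rewrite tmul_linl lt.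
- by move=> {}x c u v; rewrite tmul_linr lt.
move=> e g e' f hg hf; rewrite (tswap_pure _ _ hg) (tswap_pure _ _ hf).
rewrite (linZ (tmul_linl _)) (linZ (tmul_linr _)).
rewrite (tmul_pure (thomog_perm _ hg) (thomog_perm _ hf)).
rewrite (tmul_pure hg hf) (linZ (lt _ _ _)) (tswap_pure _ _ (thomogB hg hf)).
rewrite !scalerA -!signr_addb (koszul_swap _ _ ij) !ffunE.
congr (_ *: pure _); last by apply/ffunP => l; rewrite !ffunE.
congr (_ ^+ _); congr nat_of_bool.
by case: (koszul e e'); case: (e i); case: (e j); case: (e' i); case: (e' j).
Qed.

Fact tmul_inv (x : tpow d M) (y : tpow d N) : tinv x -> tinv y -> tinv (tmul x y).
Proof. by move=> hx hy i j ij; rewrite -tmul_swap // hx // hy. Qed.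

(* [tmul B] restricts to divided powers by [tmul_inv]. *)
Definition gmul (x : divpow d M) (y : divpow d N) : divpow d P :=
  lsubm (@tinv_sub k d P) (tmul_inv (lvalPP x) (lvalPP y)).

Lemma gmul_linl y : linear (gmul^~ y).
Proof. by move=> c u v; apply: lval_inj; exact: tmul_linl. Qed.
Lemma gmul_linr x : linear (gmul x).
Proof. by move=> c u v; apply: lval_inj; exact: tmul_linr. Qed.
Lemma gmul_even a b x y :
  homog a x -> homog b y -> homog (a (+) b) (gmul x y).
Proof.
move=> hx hy; apply: lval_inj; apply: tmul_even.
  by rewrite /homog -{2}hx.
by rewrite /homog -{2}hy.
Qed.
End TensorProduct.

Section TensorAssoc.
Variables (k : comPzRingType) (d : nat) (M1 M2 M3 M12 M23 M : supermod k).
Variables (B12 : M1 -> M2 -> M12) (B23 : M2 -> M3 -> M23)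
  (Bl : M12 -> M3 -> M) (Br : M1 -> M23 -> M).
Hypothesis B12l : forall f, linear (B12^~ f).
Hypothesis B12r : forall g, linear (B12 g).
Hypothesis B12e : forall a b g f, homog a g -> homog b f -> homog (a (+) b) (B12 g f).
Hypothesis B23l : forall f, linear (B23^~ f).
Hypothesis B23r : forall g, linear (B23 g).
Hypothesis B23e : forall a b g f, homog a g -> homog b f -> homog (a (+) b) (B23 g f).
Hypothesis Bll : forall f, linear (Bl^~ f).
Hypothesis Blr : forall g, linear (Bl g).
Hypothesis Brl : forall f, linear (Br^~ f).
Hypothesis Brr : forall g, linear (Br g).
Hypothesis BA : forall x y z, Br x (B23 y z) = Bl (B12 x y) z.

Lemma tmulA (x : tpow d M1) (y : tpow d M2) (z : tpow d M3) :
  tmul Br x (tmul B23 y z) = tmul Bl (tmul B12 x y) z.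
Proof.
apply: (tpow_exth (f := fun x => tmul Br x (tmul B23 y z))
  (g := fun x => tmul Bl (tmul B12 x y) z)).
- exact: tmul_linl.
- by move=> c u v; rewrite (tmul_linl B12l B12r) (tmul_linl Bll Blr).
move=> e1 v1 h1; apply: (tmul_ext
  (h := fun y z => tmul Br (pure v1) (tmul B23 y z))
  (h' := fun y z => tmul Bl (tmul B12 (pure v1) y) z)).
- by move=> t c u v; rewrite (tmul_linl B23l B23r) (tmul_linr Brl Brr).
- by move=> t c u v; rewrite (tmul_linr B23l B23r) (tmul_linr Brl Brr).
- by move=> t c u v; rewrite (tmul_linr B12l B12r) (tmul_linl Bll Blr).
- by move=> t c u v; rewrite (tmul_linr Bll Blr).
move=> e2 v2 e3 v3 h2 h3.
rewrite (tmul_pure B23l B23r h2 h3) (tmul_pure B12l B12r h1 h2).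
rewrite (linZ (tmul_linr Brl Brr _)) (linZ (tmul_linl Bll Blr _)).
rewrite (tmul_pure Brl Brr h1 (thomogB B23e h2 h3)).
rewrite (tmul_pure Bll Blr (thomogB B12e h1 h2) h3).
rewrite !scalerA -!signr_addb koszulDl koszulDr.
congr (_ *: pure _); last by apply/ffunP => l; rewrite !ffunE.
congr (_ ^+ _); congr nat_of_bool; do !case: koszul => //.
Qed.
End TensorAssoc.

Section TensorUnit.
Variables (k : comPzRingType) (d : nat) (M N : supermod k).

Definition tunit (u : M) : tpow d M := pure [ffun _ => u].

Lemma tunit_homog u : homog false u -> thomog [ffun _ => false] ([ffun _ => u] : {ffun 'I_d -> M}).
Proof. by move=> hu i; rewrite !ffunE. Qed.

Lemma tunit_inv u : homog false u -> tinv (tunit u).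
Proof.
move=> hu i j ij; rewrite /tunit (tswap_pure _ _ (tunit_homog hu)) !ffunE scale1r.
by congr pure; apply/ffunP => l; rewrite !ffunE.
Qed.

Lemma tmul1l (u : M) (B : M -> N -> N) (y : tpow d N) :
  (forall f, linear (B^~ f)) -> (forall g, linear (B g)) ->
  homog false u -> (forall f, B u f = f) -> tmul B (tunit u) y = y.
Proof.
move=> Bl Br hu h.
apply: (tpow_exth (f := tmul B (tunit u)) (g := id)) => // [|e v hv].
  exact: tmul_linr.
rewrite (tmul_pure Bl Br (tunit_homog hu) hv) koszul0l scale1r.
by congr pure; apply/ffunP => l; rewrite !ffunE h.
Qed.

Lemma tmul1r (u : M) (B : N -> M -> N) (y : tpow d N) :
  (forall f, linear (B^~ f)) -> (forall g, linear (B g)) ->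
  homog false u -> (forall f, B f u = f) -> tmul B y (tunit u) = y.
Proof.
move=> Bl Br hu h.
apply: (tpow_exth (f := tmul B ^~ (tunit u)) (g := id)) => // [|e v hv].
  exact: tmul_linl.
rewrite (tmul_pure Bl Br hv (tunit_homog hu)) koszul0r scale1r.
by congr pure; apply/ffunP => l; rewrite !ffunE h.
Qed.

Definition gunit (u : M) (hu : homog false u) : divpow d M :=
  lsubm (@tinv_sub k d M) (tunit_inv hu).
End TensorUnit.

Section GammaProduct.
Variable k : comPzRingType.

Lemma gmulA d (M1 M2 M3 M12 M23 M : supermod k)
    (B12 : M1 -> M2 -> M12) (B23 : M2 -> M3 -> M23)
    (Bl : M12 -> M3 -> M) (Br : M1 -> M23 -> M) l12 r12 e12 l23 r23 e23 ll lr el rl rr er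
    (x : divpow d M1) (y : divpow d M2) (z : divpow d M3) :
  (forall x y z, Br x (B23 y z) = Bl (B12 x y) z) ->
  gmul (B := Br) rl rr er x (gmul (B := B23) l23 r23 e23 y z) =
  gmul (B := Bl) ll lr el (gmul (B := B12) l12 r12 e12 x y) z.
Proof. by move=> BA; apply: lval_inj; exact: tmulA. Qed.

Lemma gmul1l d (M N : supermod k) (B : M -> N -> N) l r e (u : M)
    (hu : homog false u) (y : divpow d N) :
  (forall f, B u f = f) -> gmul (B := B) l r e (gunit d hu) y = y.
Proof. by move=> h; apply: lval_inj; exact: tmul1l. Qed.

Lemma gmul1r d (M N : supermod k) (B : N -> M -> N) l r e (u : M)
    (hu : homog false u) (y : divpow d N) :
  (forall f, B f u = f) -> gmul (B := B) l r e y (gunit d hu) = y.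
Proof. by move=> h; apply: lval_inj; exact: tmul1r. Qed.

Lemma unit_even (M : supermod k) (B : M -> M -> M) (u : M) :
  (forall f, linear (B^~ f)) -> (forall g, linear (B g)) ->
  (forall a b g f, homog a g -> homog b f -> homog (a (+) b) (B g f)) ->
  (forall f, B u f = f) -> (forall f, B f u = f) -> homog false u.
Proof.
move=> Bl Br Be u1 u2.
pose e0 := par false u; pose e1 := par true u.
have h0 : homog false e0 by exact: par_homog.
have h1 : homog true e1 by exact: par_homog.
have ue : e0 + e1 = u by exact: par_sum.
have E10 : B e1 e0 = 0.
  have E : e0 = B e0 e0 + B e1 e0 by rewrite -(linD (Bl e0)) ue u1.
  have := congr1 (par true) E; rewrite (linD (par_lin true)).
  by rewrite (homogE _ h0) (homogE _ (Be _ _ _ _ h0 h0)) (homogE _ (Be _ _ _ _ h1 h0))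
             /= add0r.
have E : e1 = B e1 e0 + B e1 e1 by rewrite -(linD (Br e1)) ue u2.
have e10 : e1 = 0.
  have := congr1 (par true) E; rewrite (linD (par_lin true)) E10 (lin0 (par_lin true)).
  by rewrite (homogE _ h1) (homogE _ (Be _ _ _ _ h1 h1)) /= addr0.
by rewrite -ue e10 addr0.
Qed.
End GammaProduct.

Record superalg (k : comPzRingType) := Superalg {
  sa_mod :> supermod k;
  smul : sa_mod -> sa_mod -> sa_mod;
  sone : sa_mod;
  smul_linl : forall y, linear (smul^~ y);
  smul_linr : forall x, linear (smul x);
  smul_even : forall a b x y,
    homog a x -> homog b y -> homog (a (+) b) (smul x y);
  smulA : forall x y z, smul x (smul y z) = smul (smul x y) z;
  smul1l : forall x, smul sone x = x;
  smul1r : forall x, smul x sone = x }.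

Record supercat (k : comPzRingType) := Supercat {
  sob :> Type;
  shom : sob -> sob -> supermod k;
  sid : forall X, shom X X;
  scomp : forall X Y Z, shom Y Z -> shom X Y -> shom X Z;
  scomp_linl : forall X Y Z f, linear (fun g => @scomp X Y Z g f);
  scomp_linr : forall X Y Z g, linear (@scomp X Y Z g);
  scomp_even : forall X Y Z a b g f,
    homog a g -> homog b f -> homog (a (+) b) (@scomp X Y Z g f);
  scompA : forall W X Y Z (h : shom Y Z) (g : shom X Y) (f : shom W X),
    scomp h (scomp g f) = scomp (scomp h g) f;
  scomp1l : forall X Y (f : shom X Y), scomp (sid Y) f = f;
  scomp1r : forall X Y (f : shom X Y), scomp f (sid X) = f }.

Lemma sone_even (k : comPzRingType) (A : superalg k) : homog false (sone A).
Proof.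
exact: unit_even (@smul_linl k A) (@smul_linr k A) (@smul_even k A)
  (@smul1l k A) (@smul1r k A).
Qed.

Lemma sid_even (k : comPzRingType) (C : supercat k) (X : C) : homog false (sid X).
Proof.
exact: unit_even (@scomp_linl k C X X X) (@scomp_linr k C X X X)
  (@scomp_even k C X X X) (@scomp1l k C X X) (@scomp1r k C X X).
Qed.

Section Endomorphisms.
Variables (k : comPzRingType) (C : supercat k).

Definition endalg (X : C) : superalg k :=
  @Superalg k (shom X X) (@scomp k C X X X) (sid X)
    (@scomp_linl k C X X X) (@scomp_linr k C X X X) (@scomp_even k C X X X)
    (@scompA k C X X X X) (@scomp1l k C X X) (@scomp1r k C X X).

Definition sfullsub (O : Type) (u : O -> C) : supercat k :=
  @Supercat k O (fun X Y => shom (u X) (u Y)) (fun X => sid (u X))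
    (fun X Y Z => @scomp k C (u X) (u Y) (u Z))
    (fun X Y Z => @scomp_linl k C (u X) (u Y) (u Z))
    (fun X Y Z => @scomp_linr k C (u X) (u Y) (u Z))
    (fun X Y Z => @scomp_even k C (u X) (u Y) (u Z))
    (fun W X Y Z => @scompA k C (u W) (u X) (u Y) (u Z))
    (fun X Y => @scomp1l k C (u X) (u Y))
    (fun X Y => @scomp1r k C (u X) (u Y)).
End Endomorphisms.

Section DividedPowers.
Variables (k : comPzRingType) (d : nat).

Section Alg.
Variable B : superalg k.
Definition galg_mul :=
  @gmul k d B B B (@smul k B) (@smul_linl k B) (@smul_linr k B) (@smul_even k B).

Definition gammaalg : superalg k.
Proof.
refine (@Superalg k (divpow d B) galg_mul (gunit d (sone_even B)) _ _ _ _ _ _).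
- exact: gmul_linl.
- exact: gmul_linr.
- exact: gmul_even.
- by move=> x y z; apply: gmulA; exact: smulA.
- by move=> x; apply: gmul1l; exact: smul1l.
- by move=> x; apply: gmul1r; exact: smul1r.
Defined.
End Alg.

Section Cat.
Variable C : supercat k.
Definition gcat_comp (X Y Z : C) :=
  @gmul k d (shom Y Z) (shom X Y) (shom X Z) (@scomp k C X Y Z)
    (@scomp_linl k C X Y Z) (@scomp_linr k C X Y Z) (@scomp_even k C X Y Z).

(* Same objects as C; the morphisms are the divided powers of those of C. *)
Definition gammacat : supercat k.
Proof.
refine (@Supercat k C (fun X Y => divpow d (shom X Y))
  (fun X => gunit d (sid_even X)) gcat_comp _ _ _ _ _ _).
- by move=> *; exact: gmul_linl.
- by move=> *; exact: gmul_linr.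
- by move=> *; exact: gmul_even.
- by move=> W X Y Z h g f; apply: gmulA; exact: scompA.
- by move=> X Y f; apply: gmul1l; exact: scomp1l.
- by move=> X Y f; apply: gmul1r; exact: scomp1r.
Defined.
End Cat.
End DividedPowers.

Section HomK.
Variables (k : comPzRingType) (M N : supermod k).

Fact linear_sub : lsub (fun f : M -> N => linear f).
Proof.
split=> [c u v|a f g lf lg c u v]; first by rewrite /= scaler0 addr0.
rewrite !fctE /= !lf !lg !scalerDr !scalerA mulrC -!addrA; congr (_ + _).
by rewrite addrCA.
Qed.

Definition homk_mod : lmodType k := lsubmod linear_sub.

(* A map has parity a when it sends degree b to degree a + b. *)
Definition homk_par_fun (a : bool) (f : M -> N) (v : M) : N :=
  par a (f (par false v)) + par (~~ a) (f (par true v)).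

Fact homk_par_fun_lin a f : linear f -> linear (homk_par_fun a f).
Proof.
move=> lf c u v; rewrite /homk_par_fun !par_lin !lf !par_lin scalerDr.
by rewrite addrACA.
Qed.

Definition homk_par (a : bool) (f : homk_mod) : homk_mod :=
  lsubm linear_sub (homk_par_fun_lin a (lvalPP f)).

Fact homk_par_lin a : linear (homk_par a).
Proof.
move=> c f g; apply: lval_inj; apply: funext => v.
by rewrite /= /homk_par_fun /= !fctE !par_lin scalerDr addrACA.
Qed.

Fact homk_par_par a b f : homk_par a (homk_par b f) = if a == b then homk_par b f else 0.
Proof.
apply: lval_inj; apply: funext => v.
rewrite /= /homk_par_fun /= /homk_par_fun !par_par /=.
rewrite !(lin0 (lvalPP f)) !(lin0 (par_lin _)) addr0 add0r !par_par.
by case: a; case: b; rewrite /= ?addr0.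
Qed.

Fact homk_par_sum f : homk_par false f + homk_par true f = f.
Proof.
apply: lval_inj; apply: funext => v.
rewrite /= fctE /homk_par_fun /= addrACA par_sum [X in _ + X]addrC par_sum.
by rewrite -(linD (lvalPP f)) par_sum.
Qed.

Definition homk : supermod k :=
  @Supermod k homk_mod homk_par homk_par_lin homk_par_par homk_par_sum.

Definition happ (f : homk) : M -> N := lval f.

Lemma happ_linear (f : homk) : linear (happ f).
Proof. exact: lvalPP f. Qed.

Lemma homk_ext (f g : homk) : happ f =1 happ g -> f = g.
Proof. by move=> h; apply: lval_inj; exact: funext. Qed.

Lemma happ_par a b (f : homk) v :
  homog b v -> happ (par a f) v = par (a (+) b) (happ f v).
Proof.
move=> hv; rewrite /happ /= /homk_par_fun !(homogE _ hv).
by case: b hv => hv /=; rewrite (lin0 (lvalPP f)) (lin0 (par_lin _)) ?addr0 ?add0r;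
   case: a.
Qed.

Lemma happ_homog a b f v : homog a f -> homog b v -> homog (a (+) b) (happ f v).
Proof. by move=> hf hv; rewrite -hf /homog -happ_par // par_homog. Qed.

Lemma homk_homog a (f : homk) :
  (forall b v, homog b v -> homog (a (+) b) (happ f v)) -> homog a f.
Proof.
move=> h; apply: homk_ext; apply: super_ext; try exact: happ_linear.
by move=> b v hv; rewrite (happ_par _ _ hv); exact: h.
Qed.
End HomK.

Section SupermodCat.
Variable k : comPzRingType.

Fact id_linear (M : supermod k) : linear (@id M).
Proof. by []. Qed.

Definition hid (M : supermod k) : homk M M := lsubm (linear_sub M M) (@id_linear M).

Definition hcomp (M N P : supermod k) (g : homk N P) (f : homk M N) : homk M P :=
  lsubm (linear_sub M P) (lin_comp (happ_linear g) (happ_linear f)).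

Definition smodcat : supercat k.
Proof.
refine (@Supercat k (supermod k) (@homk k) hid hcomp _ _ _ _ _ _).
- by move=> X Y Z f c u v; apply: homk_ext.
- by move=> X Y Z g c u v; apply: homk_ext => x; exact: happ_linear.
- move=> X Y Z a b g f hg hf; apply: homk_homog => c v hv.
  by rewrite -addbA; apply: (happ_homog (v := happ f v) hg); exact: happ_homog.
- by move=> *; exact: homk_ext.
- by move=> *; exact: homk_ext.
- by move=> *; exact: homk_ext.
Defined.
End SupermodCat.

Lemma happ_even (k : comPzRingType) (M N : supermod k) (f : homk M N) a v :
  homog false f -> par a (happ f v) = happ f (par a v).
Proof.
move=> hf; apply: (super_ext (f := fun v => par a (happ f v))
  (g := fun v => happ f (par a v))) => [||b w hw].
- exact: lin_comp (par_lin a) (happ_linear f).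
- exact: lin_comp (happ_linear f) (par_lin a).
rewrite (homogE a (happ_homog hf hw)) (homogE a hw) addFb.
by case: ifP => // _; rewrite (lin0 (happ_linear f)).
Qed.

Lemma par_scomp (k : comPzRingType) (C : supercat k) (X Y Z : C)
    (g : shom Y Z) (f : shom X Y) e :
  par e (scomp g f) =
  scomp (par e g) (par false f) + scomp (par (~~ e) g) (par true f).
Proof.
have hh (b c : bool) : homog (b (+) c) (scomp (par b g) (par c f)).
  by apply: scomp_even; exact: par_homog.
have {1}-> : scomp g f =
    (scomp (par false g) (par false f) + scomp (par true g) (par false f)) +
    (scomp (par false g) (par true f) + scomp (par true g) (par true f)).
  by rewrite -!(linD (scomp_linl _)) -(linD (scomp_linr _)) !par_sum.
rewrite !(linD (par_lin e)) !(homogE e (hh _ _)) /=.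
by case: e; rewrite /= ?addr0 ?add0r.
Qed.

Record rsupermod (k : comPzRingType) (A : superalg k) := RSupermod {
  rs_mod :> supermod k;
  ract : rs_mod -> A -> rs_mod;
  ract_linl : forall x, linear (ract^~ x);
  ract_linr : forall v, linear (ract v);
  ract_even : forall a b v x,
    homog a v -> homog b x -> homog (a (+) b) (ract v x);
  ractA : forall v x y, ract v (smul x y) = ract (ract v x) y;
  ract1 : forall v, ract v (sone A) = v }.

Section RightModules.
Variables (k : comPzRingType) (A : superalg k).

Definition right_linear (M N : rsupermod A) (f : homk M N) : Prop :=
  forall v x, happ f (ract v x) = ract (happ f v) x.

Fact right_linear_sub M N : lsub (@right_linear M N).
Proof.
split=> [v x|c f g hf hg v x]; first by rewrite (lin0 (ract_linl x)).
have E w : happ (c *: f + g) w = c *: happ f w + happ g w by [].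
by rewrite !E hf hg (ract_linl x).
Qed.

Fact right_linear_par (M N : rsupermod A) a (f : homk M N) :
  right_linear f -> right_linear (par a f).
Proof.
move=> hf v x.
apply: (super_ext (f := fun x => happ (par a f) (ract v x))
  (g := fun x => ract (happ (par a f) v) x)) => [||b {}x hx].
- exact: lin_comp (happ_linear _) (ract_linr v).
- exact: ract_linr.
apply: (super_ext (f := fun v => happ (par a f) (ract v x))
  (g := fun v => ract (happ (par a f) v) x)) => [||c {}v hv].
- exact: lin_comp (happ_linear _) (ract_linl x).
- exact: lin_comp (ract_linl x) (happ_linear _).
rewrite (happ_par _ _ (ract_even hv hx)) (happ_par _ _ hv) hf.
move: (happ f v) => w; rewrite addbA; move: (a (+) c) => s.
have hh t : homog (t (+) b) (ract (par t w) x) by apply: ract_even; first exact: par_homog.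
rewrite -{1}(par_sum w) (linD (ract_linl x)) (linD (par_lin _)).
rewrite (homogE _ (hh false)) (homogE _ (hh true)).
by case: s; case: (b) => /=; rewrite ?addr0 ?add0r.
Qed.

Definition homA (M N : rsupermod A) : supermod k :=
  subsuper (@right_linear_sub M N) (@right_linear_par M N).

Definition rapp (M N : rsupermod A) (f : homA M N) : M -> N := happ (lval f).

Fact hid_right (M : rsupermod A) : right_linear (hid M).
Proof. by []. Qed.

Fact hcomp_right (M N P : rsupermod A) (g : homA N P) (f : homA M N) :
  right_linear (hcomp (lval g) (lval f)).
Proof.
move=> v x; have E w : happ (hcomp (lval g) (lval f)) w = rapp g (rapp f w) by [].
by rewrite !E /rapp (lvalPP f) (lvalPP g).
Qed.

Definition homA_comp (M N P : rsupermod A) (g : homA N P) (f : homA M N) :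
  homA M P := lsubm (@right_linear_sub M P) (hcomp_right g f).

Definition rmodcat : supercat k.
Proof.
refine (@Supercat k (rsupermod A) homA
  (fun M => lsubm (@right_linear_sub M M) (@hid_right M)) homA_comp _ _ _ _ _ _).
- by move=> X Y Z f c u v; apply: lval_inj; exact: (@scomp_linl k (smodcat k)).
- by move=> X Y Z g c u v; apply: lval_inj; exact: (@scomp_linr k (smodcat k)).
- move=> X Y Z a b g f hg hf; apply: lval_inj.
  apply: (@scomp_even k (smodcat k)).
    by rewrite /homog -{2}hg.
  by rewrite /homog -{2}hf.
- by move=> *; apply: lval_inj; apply: homk_ext => v.
- by move=> *; apply: lval_inj; apply: homk_ext => v.
- by move=> *; apply: lval_inj; apply: homk_ext => v.
Defined.

Lemma homA_homog (M N : rsupermod A) a (f : homA M N) :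
  homog a f <-> homog (M := homk M N) a (lval f).
Proof. by split=> [h|h]; [rewrite /homog -{2}h | exact: lval_inj]. Qed.

Definition rfg (M : rsupermod A) : Prop :=
  exists r (g : 'I_r -> M), forall v, exists c : 'I_r -> A,
    v = \sum_(i < r) ract (g i) (c i).

(* Projectivity in the abelian category of right A-supermodules and even
   homomorphisms, whose epimorphisms are the surjections. *)
Definition rprojective (M : rsupermod A) : Prop :=
  forall (N N' : rsupermod A) (g : homA N N') (f : homA M N'),
    homog false g -> homog false f -> (forall y, exists x, rapp g x = y) ->
    exists2 h : homA M N, homog false h & homA_comp g h = f.

(* The direct sum over i of copies of A, the i-th one with its grading shifted
   when [s i] holds (on a right supermodule the shift leaves the action as it
   is). *)
Section Free.
Variables (I : finType) (s : I -> bool).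

Definition free_par (a : bool) (v : {ffun I -> A}) : {ffun I -> A} :=
  [ffun i => par (a (+) s i) (v i)].
Fact free_par_lin a : linear (free_par a).
Proof. by move=> c u v; apply/ffunP => i; rewrite !ffunE par_lin. Qed.
Fact free_par_par a b v : free_par a (free_par b v) = if a == b then free_par b v else 0.
Proof.
apply/ffunP => i; rewrite !ffunE par_par.
have -> : (a (+) s i == b (+) s i) = (a == b) by case: a; case: b; case: (s i).
by case: (a == b); rewrite !ffunE.
Qed.
Fact free_par_sum v : free_par false v + free_par true v = v.
Proof.
apply/ffunP => i; rewrite !ffunE.
by case: (s i); rewrite /= ?par_sum // addrC par_sum.
Qed.
Definition free_super : supermod k :=
  @Supermod k {ffun I -> A} free_par free_par_lin free_par_par free_par_sum.

Definition free_act (v : {ffun I -> A}) (x : A) : {ffun I -> A} :=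
  [ffun i => smul (v i) x].

Definition freemod : rsupermod A.
Proof.
refine (@RSupermod k A free_super free_act _ _ _ _ _).
- by move=> x c u v; apply/ffunP => i; rewrite !ffunE (smul_linl x).
- by move=> v c x y; apply/ffunP => i; rewrite !ffunE (smul_linr (v i)).
- move=> a b v x hv hx; apply/ffunP => i; rewrite !ffunE addbAC.
  by apply: smul_even => //; rewrite /homog -{2}hv ffunE.
- by move=> v x y; apply/ffunP => i; rewrite !ffunE smulA.
- by move=> v; apply/ffunP => i; rewrite !ffunE smul1r.
Defined.

Definition free_gen (i : I) : freemod := [ffun j => if j == i then sone A else 0].

Lemma free_gen_homog i : homog (s i) (free_gen i).
Proof.
apply/ffunP => j; rewrite !ffunE; case: eqP => [->|_].
  by rewrite addbb; exact: sone_even.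
exact: (lin0 (par_lin _)).
Qed.

Lemma free_genE (v : freemod) : v = \sum_i ract (free_gen i) ((v : {ffun I -> A}) i).
Proof.
apply/ffunP => j; rewrite sum_ffunE (bigD1 j) //= big1 => [|i /negPf ij].
  by rewrite !ffunE eqxx smul1l addr0.
by rewrite !ffunE eq_sym ij (lin0 (smul_linl _)).
Qed.

Lemma free_fg : rfg freemod.
Proof.
exists #|I|, (fun i => free_gen (enum_val i)) => v.
exists (fun i => (v : {ffun I -> A}) (enum_val i)); rewrite {1}(free_genE v).
by rewrite (reindex (@enum_val I predT)) //; exact/onW_bij/enum_val_bij.
Qed.

Lemma free_projective : rprojective freemod.
Proof.
move=> N N' g f /homA_homog hg /homA_homog hf gs.
have /choice[w hw] i : exists w : N, homog (s i) w /\ rapp g w = rapp f (free_gen i).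
  have [x gx] := gs (rapp f (free_gen i)); exists (par (s i) x); split.
    exact: par_homog.
  by rewrite /rapp -happ_even // -/(rapp g x) gx /rapp happ_even // free_gen_homog.
pose h (v : freemod) : N := \sum_i ract (w i) ((v : {ffun I -> A}) i).
have lh : linear h.
  move=> c u v; rewrite /h scaler_sumr -big_split; apply: eq_bigr => i _ /=.
  by rewrite !ffunE (ract_linr (w i)).
pose hk : homk freemod N := lsubm (linear_sub _ _) lh.
have rh : right_linear hk.
  move=> v x; rewrite /happ /= /h.
  rewrite (lin_sum (ract_linl x)); apply: eq_bigr => i _.
  by rewrite /free_act ffunE ractA.
exists (lsubm (@right_linear_sub freemod N) rh).
  apply/homA_homog; apply: homk_homog => b v hv; rewrite addFb /= /happ /= /h.
  rewrite /homog (lin_sum (par_lin b)); apply: eq_bigr => i _.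
  have hvi : homog (b (+) s i) ((v : {ffun I -> A}) i).
    by rewrite /homog -{2}hv ffunE.
  have := ract_even (hw i).1 hvi.
  by rewrite addbCA addbb addbF.
apply: lval_inj; apply: homk_ext => v.
change (happ (lval g) (h v) = happ (lval f) v).
rewrite /h (lin_sum (happ_linear (lval g))).
have -> : happ (lval f) v =
    \sum_i happ (lval f) (ract (free_gen i) ((v : {ffun I -> A}) i)).
  rewrite {1}(free_genE v); exact: (lin_sum (happ_linear (lval f))).
apply: eq_bigr => i _; rewrite (lvalPP g) -/(rapp g _) (hw i).2.
by rewrite /rapp -(lvalPP f).
Qed.
End Free.

Definition Asuper (m n : nat) : rsupermod A :=
  @freemod ('I_m + 'I_n)%type (fun i => if i is inr _ then true else false).
Definition Aeven (n : nat) : rsupermod A := @freemod 'I_n (fun => false).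

Definition evenly_generated (M : rsupermod A) : Prop :=
  exists p (f : homA (Aeven p) M), homog false f /\ forall y, exists x, rapp f x = y.

Definition VA_ob := {M : rmodcat | rfg M /\ rprojective M}.
Definition VA : supercat k := sfullsub (C := rmodcat) (fun M : VA_ob => sval M).

Definition EA_ob := {M : VA | evenly_generated (sval M)}.
Definition EA : supercat k := sfullsub (C := VA) (fun M : EA_ob => sval M).

Definition AsuperV (m n : nat) : VA :=
  exist _ (Asuper m n) (conj (free_fg _) (@free_projective _ _)).

Fact Aeven_evenly_generated n : evenly_generated (Aeven n).
Proof.
exists n, (sid (Aeven n : rmodcat)); split; first exact: (@sid_even k rmodcat).
by move=> y; exists y.
Qed.

Definition AevenE (n : nat) : EA :=
  exist _ (exist _ (Aeven n) (conj (free_fg _) (@free_projective _ _)) : VA)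
    (Aeven_evenly_generated n).

Definition schur (m n d : nat) : superalg k :=
  gammaalg d (@endalg k rmodcat (Asuper m n)).
Definition schur_even (n d : nat) : superalg k :=
  gammaalg d (@endalg k rmodcat (Aeven n)).
End RightModules.

Section Vk.
Variable k : comPzRingType.

Definition kfg (M : lmodType k) : Prop :=
  exists r (g : 'I_r -> M), forall v, exists c : 'I_r -> k,
    v = \sum_(i < r) c i *: g i.

Definition kprojective (M : supermod k) : Prop :=
  forall (N N' : supermod k) (g : homk N N') (f : homk M N'),
    homog false g -> homog false f -> (forall y, exists x, happ g x = y) ->
    exists2 h : homk M N, homog false h & hcomp g h = f.

Definition in_Vk (M : supermod k) : Prop := kfg M /\ kprojective M.

Definition Vk_ob := {M : smodcat k | in_Vk M}.
Definition Vk : supercat k := sfullsub (C := smodcat k) (fun M : Vk_ob => sval M).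

Definition fgfree (M : lmodType k) : Prop :=
  exists r (b : 'I_r -> M), forall v, exists! c : {ffun 'I_r -> k},
    v = \sum_(i < r) c i *: b i.

Definition is_field : Prop :=
  (1 : k) <> 0 /\ forall x : k, x <> 0 -> exists y, x * y = 1.
End Vk.

Record category := Category {
  ob :> Type;
  hom : ob -> ob -> Type;
  idm : forall X, hom X X;
  comp : forall X Y Z, hom Y Z -> hom X Y -> hom X Z;
  compA : forall W X Y Z (h : hom Y Z) (g : hom X Y) (f : hom W X),
    comp h (comp g f) = comp (comp h g) f;
  comp1l : forall X Y (f : hom X Y), comp (idm Y) f = f;
  comp1r : forall X Y (f : hom X Y), comp f (idm X) = f }.
Arguments idm {c} X.

Record functor (C D : category) := Functor {
  fo :> C -> D;
  fh : forall X Y, hom X Y -> hom (fo X) (fo Y);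
  fh_id : forall X, fh (idm X) = idm (fo X);
  fh_comp : forall X Y Z (g : hom Y Z) (f : hom X Y),
    fh (comp g f) = comp (fh g) (fh f) }.

Definition idfunctor (C : category) : functor C C :=
  @Functor C C id (fun _ _ f => f) (fun _ => erefl) (fun _ _ _ _ _ => erefl).

Definition compfunctor (C D E : category) (G : functor D E) (F : functor C D) :
  functor C E.
Proof.
refine (@Functor C E (fun X => G (F X)) (fun X Y f => fh G (fh F f)) _ _).
- by move=> X; rewrite !fh_id.
- by move=> X Y Z g f; rewrite !fh_comp.
Defined.

Definition natiso (C D : category) (F G : functor C D) : Prop :=
  exists (a : forall X, hom (F X) (G X)) (b : forall X, hom (G X) (F X)),
    [/\ forall X, comp (b X) (a X) = idm (F X),
        forall X, comp (a X) (b X) = idm (G X)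
      & forall X Y (f : hom X Y), comp (fh G f) (a X) = comp (a Y) (fh F f)].

Definition is_equivalence (C D : category) (F : functor C D) : Prop :=
  exists G : functor D C,
    natiso (idfunctor C) (compfunctor G F) /\ natiso (compfunctor F G) (idfunctor D).

Definition fullsub (C : category) (P : C -> Prop) : category :=
  @Category {X : C | P X} (fun X Y => hom (sval X) (sval Y)) (fun X => idm (sval X))
    (fun X Y Z => @comp C (sval X) (sval Y) (sval Z))
    (fun W X Y Z => @compA C (sval W) (sval X) (sval Y) (sval Z))
    (fun X Y => @comp1l C (sval X) (sval Y))
    (fun X Y => @comp1r C (sval X) (sval Y)).

Definition corestrict (C D : category) (F : functor C D) (P : D -> Prop)
    (FP : forall X, P (F X)) : functor C (fullsub P) :=
  @Functor C (fullsub P) (fun X => exist P (F X) (FP X)) (fun X Y f => fh F f)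
    (fh_id F) (@fh_comp C D F).

Record sfunctor (k : comPzRingType) (C D : supercat k) := Sfunctor {
  sfo :> C -> D;
  sfh : forall X Y, shom X Y -> shom (sfo X) (sfo Y);
  sfh_lin : forall X Y, linear (@sfh X Y);
  sfh_even : forall X Y a (f : shom X Y), homog a f -> homog a (sfh f);
  sfh_id : forall X, sfh (sid X) = sid (sfo X);
  sfh_comp : forall X Y Z (g : shom Y Z) (f : shom X Y),
    sfh (scomp g f) = scomp (sfh g) (sfh f) }.

Section SuperNat.
Variables (k : comPzRingType) (C D : supercat k).

(* The components of eta need not be homogeneous: [e] ranges over the parities
   of their homogeneous parts. *)
Definition snatural (F G : sfunctor C D) (eta : forall X, shom (F X) (G X)) : Prop :=
  forall e a X Y (f : shom X Y), homog a f ->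
    scomp (sfh G f) (par e (eta X)) =
    (-1) ^+ (e && a) *: scomp (par e (eta Y)) (sfh F f).

Definition snat (F G : sfunctor C D) : Type := {eta | @snatural F G eta}.

Fact snat_id_subproof (F : sfunctor C D) : @snatural F F (fun X => sid (F X)).
Proof.
move=> e a X Y f hf; rewrite !(homogE _ (sid_even _)).
case: e => /=; last by rewrite scale1r scomp1l scomp1r.
by rewrite (lin0 (scomp_linr _)) (lin0 (scomp_linl _)) scaler0.
Qed.

Fact snat_comp_subproof (F G H : sfunctor C D) (t : snat G H) (n : snat F G) :
  @snatural F H (fun X => scomp (sval t X) (sval n X)).
Proof.
move=> e a X Y f hf; rewrite !par_scomp (linD (scomp_linr _)) (linD (scomp_linl _)).
have step b c : scomp (sfh H f) (scomp (par b (sval t X)) (par c (sval n X))) =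
    (-1) ^+ ((b (+) c) && a) *:
      scomp (scomp (par b (sval t Y)) (par c (sval n Y))) (sfh F f).
  rewrite scompA (svalP t b _ _ _ _ hf) (linZ (scomp_linl _)) -scompA.
  rewrite (svalP n c _ _ _ _ hf) (linZ (scomp_linr _)) scompA scalerA -signr_addb.
  by case: a {hf}; case: b; case: c.
by rewrite !step scalerDr addbF addbT negbK.
Qed.

Definition sfunctorcat : category.
Proof.
refine (@Category (sfunctor C D) snat (fun F => exist _ _ (@snat_id_subproof F))
  (fun F G H t n => exist _ _ (snat_comp_subproof t n)) _ _ _).
- by move=> *; apply: eq_exist; apply: functional_extensionality_dep => X; exact: scompA.
- by move=> F G [n hn]; apply: eq_exist; apply: functional_extensionality_dep => X;
    exact: scomp1l.
- by move=> F G [n hn]; apply: eq_exist; apply: functional_extensionality_dep => X;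
    exact: scomp1r.
Defined.
End SuperNat.

Definition Pcat (k : comPzRingType) (d : nat) (C : supercat k) : category :=
  sfunctorcat (gammacat d C) (Vk k).

Record lsupermod (k : comPzRingType) (S : superalg k) := LSupermod {
  ls_mod :> supermod k;
  lact : S -> ls_mod -> ls_mod;
  lact_linl : forall v, linear (lact^~ v);
  lact_linr : forall s, linear (lact s);
  lact_even : forall a b s v,
    homog a s -> homog b v -> homog (a (+) b) (lact s v);
  lactA : forall s t v, lact (smul s t) v = lact s (lact t v);
  lact1 : forall v, lact (sone S) v = v }.

Section LeftModules.
Variables (k : comPzRingType) (S : superalg k).

Definition left_linear (M N : lsupermod S) (f : homk M N) : Prop :=
  forall e a (s : S) v, homog a s ->
    happ (par e f) (lact s v) = (-1) ^+ (e && a) *: lact s (happ (par e f) v).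

Definition lhom (M N : lsupermod S) : Type := {f : homk M N | left_linear f}.

Fact left_linear_id (M : lsupermod S) : left_linear (hid M).
Proof.
move=> e a s v hs; rewrite (homogE e (@sid_even k (smodcat k) M)).
by case: e => /=; rewrite ?scale1r // (lin0 (lact_linr s)) scaler0.
Qed.

Fact left_linear_comp (M N P : lsupermod S) (g : lhom N P) (f : lhom M N) :
  left_linear (hcomp (sval g) (sval f)).
Proof.
move=> e a s v hs; rewrite (@par_scomp k (smodcat k)).
have E (x y : homk M P) w : happ (x + y) w = happ x w + happ y w by [].
have Ec b c w : happ (hcomp (par b (sval g)) (par c (sval f))) w =
  happ (par b (sval g)) (happ (par c (sval f)) w) by [].
have step b c w : happ (hcomp (par b (sval g)) (par c (sval f))) (lact s w) =
    (-1) ^+ ((b (+) c) && a) *: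
      lact s (happ (hcomp (par b (sval g)) (par c (sval f))) w).
  rewrite !Ec (svalP f c _ _ _ hs) (linZ (happ_linear _)) (svalP g b _ _ _ hs).
  by rewrite scalerA -signr_addb; case: a {hs}; case: b; case: c.
rewrite !E (step e false) (step (~~ e) true) addbF addbT negbK.
by rewrite (linD (lact_linr s)) scalerDr.
Qed.

Definition lfg (M : lsupermod S) : Prop :=
  exists r (g : 'I_r -> M), forall v, exists c : 'I_r -> S,
    v = \sum_(i < r) lact (c i) (g i).

Definition lmodcat : category.
Proof.
refine (@Category (lsupermod S) lhom (fun M => exist _ _ (@left_linear_id M))
  (fun M N P g f => exist _ _ (left_linear_comp g f)) _ _ _).
- by move=> *; apply: eq_exist; exact: homk_ext.
- by move=> M N [f hf]; apply: eq_exist; exact: homk_ext.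
- by move=> M N [f hf]; apply: eq_exist; exact: homk_ext.
Defined.

Definition Smod : category := fullsub (C := lmodcat) lfg.

(* Evaluation takes values in Vk, hence in this full subcategory of [Smod].  When
   k is a field the two categories coincide; over a general k, [Smod] also has
   objects that are not k-projective, and these are not isomorphic to any value
   of a functor: for k = A the integers and m = n = d = 1, S is the matrix
   superalgebra M_(1|1)(k), which acts on the finite group k/2 + k/2. *)
Definition SmodV : category := fullsub (C := Smod) (fun M => in_Vk (sval M)).
End LeftModules.

Section Evaluation.
Variables (k : comPzRingType) (d : nat) (C : supercat k) (X : C).
Let S := gammaalg d (endalg X).

Definition eval_act (F : Pcat d C) (s : S) : sval (F X) -> sval (F X) :=
  happ (@sfh k (gammacat d C) (Vk k) F X X s).

Definition eval_mod (F : Pcat d C) : lsupermod S.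
Proof.
refine (@LSupermod k S (sval (F X)) (@eval_act F) _ _ _ _ _).
- move=> v c s t; rewrite /eval_act (@sfh_lin _ _ _ F).
  by [].
- by move=> s; exact: happ_linear.
- by move=> a b s v hs hv; apply: happ_homog => //; apply: (@sfh_even _ _ _ F).
- move=> s t v; rewrite /eval_act.
  have -> : @sfh _ _ _ F X X (smul s t) = scomp (@sfh _ _ _ F X X s) (@sfh _ _ _ F X X t).
    exact: (@sfh_comp _ _ _ F).
  by [].
- move=> v; rewrite /eval_act.
  have -> : sone S = @sid k (gammacat d C) X by exact: lval_inj.
  have := @sfh_id k (gammacat d C) (Vk k) F X.
  by move=> /(congr1 (fun h => happ h v)).
Defined.

Fact eval_fg (F : Pcat d C) : lfg (eval_mod F).
Proof.
have [[r [g gP]] _] := svalP (F X); exists r, g => v; have [c ->] := gP v.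
exists (fun i => c i *: sone S); apply: eq_bigr => i _.
by rewrite (linZ (lact_linl _)) lact1.
Qed.

Fact eval_left_linear (F G : Pcat d C) (n : hom F G) :
  @left_linear k S (eval_mod F) (eval_mod G) (sval n X).
Proof.
move=> e a s v hs.
have /(congr1 (fun h => happ h v)) E := svalP n e a X X s hs.
have {}E : lact (l := eval_mod G) s (happ (par e (sval n X)) v) =
  (-1) ^+ (e && a) *: happ (par e (sval n X)) (lact (l := eval_mod F) s v) := E.
by rewrite E scalerA -signr_addb addbb scale1r.
Qed.

Definition eval : functor (Pcat d C) (Smod S).
Proof.
refine (@Functor (Pcat d C) (Smod S)
  (fun F => exist _ (eval_mod F) (@eval_fg F))
  (fun F G n => exist _ (sval n X) (eval_left_linear n)) _ _).
- by move=> F; apply: eq_exist.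
- by move=> F G H g f; apply: eq_exist.
Defined.

Definition evalV : functor (Pcat d C) (SmodV S) :=
  corestrict (F := eval) (P := fun M : Smod S => in_Vk (sval M))
    (fun F : Pcat d C => svalP ((F : sfunctor _ _) X)).
End Evaluation.

(* Main.v *)
(* The identity of an object Y of the divided power category is a finite sum of
   composites of even morphisms Y -> X -> Y, where X is the free supermodule at
   which one evaluates.  Indeed the identity of Y is a sum of even
   endomorphisms e_i factoring through A or its parity shift; by polarization
   the d-th power of a sum of more than d of them is an integral combination of
   the d-th powers of the shorter partial sums, and a sum of at most d of them
   factors through X because X contains d copies of A (and of its shift).
   A Morita argument then applies: with id_Y = sum_i f_i g_i, the functor
   attached to an S-module M sends Y to the space of column vectors over M
   fixed by the idempotent matrix (g_i f_j) over S, and h to the matrix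
   (g_i h f_j).  As the f_i and g_i are even, no signs occur.  Over a field every
   finitely generated S-module is finite dimensional, hence projective over k. *)

Require Import Defs.
From mathcomp Require Import all_boot all_algebra.
From mathcomp Require Import boolp functions zify.
(* Imported again because the previous line shadows [hom]. *)
Require Import Defs.

Set Implicit Arguments.
Unset Strict Implicit.
Unset Printing Implicit Defensive.
Import GRing.Theory.
Local Open Scope ring_scope.

(** * Polarization *)

Lemma lsub_sum (k : comPzRingType) (V : lmodType k) (P : V -> Prop)
    (I : Type) (r : seq I) (Q : pred I) (E : I -> V) :
  lsub P -> (forall i, Q i -> P (E i)) -> P (\sum_(i <- r | Q i) E i).
Proof.
move=> [P0 PD] PE; apply: big_ind => // u v Pu Pv.
by rewrite -[u]scale1r; exact: PD.
Qed.

Lemma lsubZ (k : comPzRingType) (V : lmodType k) (P : V -> Prop) c v :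
  lsub P -> P v -> P (c *: v).
Proof. by move=> [P0 PD] Pv; rewrite -[c *: v]addr0; exact: PD. Qed.

Section Polarization.
Variables (k : comPzRingType) (d : nat) (T : finType).

(** Toggling a fixed element of J outside A pairs the subsets off with opposite signs. *)
Lemma signed_subsets_sum0 (N : lmodType k) (A J : {set T}) (x : N) :
  A \proper J ->
  \sum_(I : {set T} | (A \subset I) && (I \subset J)) (-1) ^+ #|I| *: x = 0.
Proof.
move=> /properP[AJ [j jJ jA]]; rewrite (bigID (fun I : {set T} => j \in I)) /=.
rewrite (reindex_onto (fun I => j |: I) (fun I => I :\ j)) /=; last first.
  by move=> I /andP[_ jI]; rewrite setD1K.
rewrite -[RHS](subrr (\sum_(I : {set T} | (A \subset I) && (I \subset J) && (j \notin I))
  (-1) ^+ #|I| *: x)) addrC; congr (_ + _).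
rewrite -sumrN; apply: eq_big => [I|I]; last first.
  move=> /andP[_ /eqP E].
  have jI : j \notin I by rewrite -E !inE eqxx.
  by rewrite cardsU1 jI exprS mulN1r scaleNr.
rewrite setU11 andbT subUset sub1set jJ /=.
have -> : (((j |: I) :\ j) == I) = (j \notin I).
  apply/eqP/idP => [<-|jI]; first by rewrite !inE eqxx.
  by rewrite setU1K.
case jI: (j \in I); rewrite ?andbF //= !andbT; congr (_ && _).
apply/subsetP/subsetP => h t tA.
  have := h t tA; rewrite !inE => /orP[/eqP tj|//].
  by move: jA; rewrite -tj tA.
by rewrite !inE h ?orbT.
Qed.

Variables (M N : lmodType k) (f : {ffun 'I_d -> M} -> N).
Hypothesis mf : multilinear f.
Variable E : T -> M.

Let mix (l : seq 'I_d) (x : M) (v : {ffun 'I_d -> M}) : {ffun 'I_d -> M} :=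
  [ffun i => if i \in l then x else v i].

(** Expanding the d equal entries one after the other fixes at most d indices that I must contain.
    As J has more than d elements, one of them stays free, and the signed sum over I cancels. *)
Lemma multilinear_polarization (J : {set T}) : (d < #|J|)%N ->
  \sum_(I : {set T} | I \subset J)
     (-1) ^+ #|I| *: f [ffun _ => \sum_(j in I) E j] = 0.
Proof.
move=> dJ.
(* The list l holds the slots still to be expanded and A the indices already chosen. The bound on
   [size l] keeps A proper in J when no slot is left. *)
suff S (l : seq 'I_d) : forall (A : {set T}) (v : {ffun 'I_d -> M}),
    uniq l -> A \subset J -> (size l < #|J :\: A|)%N ->
    \sum_(I : {set T} | (A \subset I) && (I \subset J))
      (-1) ^+ #|I| *: f (mix l (\sum_(j in I) E j) v) = 0.
  have := S (enum 'I_d) set0 0 (enum_uniq _) (sub0set _).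
  rewrite setD0 size_enum_ord => /(_ dJ) S0; rewrite -[RHS]S0.
  apply: eq_big => I; first by rewrite sub0set.
  by move=> _; congr (_ *: f _); apply/ffunP => i; rewrite !ffunE mem_enum.
elim: l => [|i l IH] A v.
  move=> _ AJ; rewrite card_gt0 => nJ.
  rewrite -[RHS](signed_subsets_sum0 (A := A) (J := J) (f v)); last first.
    by rewrite properE AJ /= -setD_eq0.
  apply: eq_bigr => I _; congr (_ *: f _).
  by apply/ffunP => j; rewrite ffunE.
move=> /= /andP[il ul] AJ sJ.
have mixS x y w : mix l x (tupd w i y) = tupd (mix l x w) i y.
  apply/ffunP => j; rewrite !ffunE; case: (j =P i) => [->|_] //.
  by rewrite (negPf il).
have mixC x w : mix (i :: l) x w = tupd (mix l x w) i x.
  by apply/ffunP => j; rewrite !ffunE inE; case: (j =P i).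
pose g (I : {set T}) j := (-1) ^+ #|I| *: f (mix l (\sum_(j in I) E j) (tupd v i (E j))).
transitivity (\sum_(I : {set T} | (A \subset I) && (I \subset J)) \sum_(j in I) g I j).
  apply: eq_bigr => I _; rewrite mixC (lin_sum (mf _ i)) scaler_sumr.
  by apply: eq_bigr => j _; rewrite /g mixS.
(* For a fixed choice j in the slot i, the remaining sum runs over the I that contain both A and
   j. *)
rewrite (exchange_big_dep predT) //= big1 // => j _.
have [jJ|jJ] := boolP (j \in J); last first.
  rewrite big_pred0 // => I; apply/negP => /andP[/andP[_ /subsetP IJ] /IJ jJ'].
  by rewrite jJ' in jJ.
rewrite -[RHS](IH (j |: A) (tupd v i (E j))) //.
- apply: eq_bigl => I; rewrite subUset sub1set.
  by rewrite [(j \in I) && _]andbC -!andbA; congr (_ && _); rewrite andbC.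
- by rewrite subUset sub1set jJ.
(* The index j may already lie in A, so the complement of A in J shrinks by at most one, as does
   l. *)
have := sJ; rewrite (cardsD1 j (J :\: A)) => h.
rewrite (_ : J :\: (j |: A) = (J :\: A) :\ j).
  by move: h; case: (_ \in _); lia.
by apply/setP => t; rewrite !inE negb_or andbA.
Qed.
End Polarization.

Lemma homog_sum (k : comPzRingType) (M : supermod k) (a : bool)
    (I : Type) (r : seq I) (P : pred I) (E : I -> M) :
  (forall i, P i -> homog a (E i)) -> homog a (\sum_(i <- r | P i) E i).
Proof. exact: lsub_sum (homog_sub M a). Qed.

Section Gunit.
Variables (k : comPzRingType) (d : nat).

Lemma gunit_irr (M : supermod k) (u v : M) (hu : homog false u) (hv : homog false v) :
  u = v -> gunit d hu = gunit d hv.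
Proof. by move=> uv; apply: lval_inj; rewrite /= uv. Qed.

Lemma gunit_even (M : supermod k) (u : M) (hu : homog false u) :
  homog false (gunit d hu).
Proof.
apply: lval_inj => /=; rewrite (tpar_pure _ (tunit_homog hu)).
by rewrite /parity big1 // => i _; rewrite ffunE.
Qed.

(** All entries are even, so the Koszul sign is trivial and d-th powers of even morphisms compose as
    the morphisms do. *)
Lemma gunit_comp (C : supercat k) (X Y Z : C) (g : shom Y Z) (f : shom X Y)
    (hg : homog false g) (hf : homog false f) (hgf : homog false (scomp g f)) :
  @scomp k (gammacat d C) X Y Z (gunit d hg) (gunit d hf) = gunit d hgf.
Proof.
apply: lval_inj.
have h := @tmul_pure k d _ _ _ _ (@scomp_linl k C X Y Z) (@scomp_linr k C X Y Z)
  _ _ _ _ (tunit_homog hg) (tunit_homog hf).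
rewrite /= /tunit h koszul0l scale1r; congr pure.
by apply/ffunP => i; rewrite !ffunE.
Qed.

Lemma gunit_polarization (M : supermod k) (T : finType) (E : T -> M)
    (hE : forall I : {set T}, homog false (\sum_(j in I) E j)) (J : {set T}) :
  (d < #|J|)%N ->
  \sum_(I : {set T} | I \subset J) (-1) ^+ #|I| *: gunit d (hE I) = 0.
Proof.
move=> dJ; apply: lval_inj.
rewrite (lin_sum (@lval_linear _ _ _ (@tinv_sub k d M))).
rewrite -[RHS](multilinear_polarization (@pure_multilinear k d M) E dJ).
by apply: eq_bigr.
Qed.
End Gunit.

(** * Factorization of endomorphisms through one object *)

Section Factor.
Variables (k : comPzRingType) (D : supercat k) (X : D).

(** Being a sum of such composites replaces a factorization through a finite direct sum of copies of
    X, which need not exist in D. *)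
Definition factors_through (Y : D) (h : shom Y Y) : Prop :=
  exists r (f : 'I_r -> shom X Y) (g : 'I_r -> shom Y X),
    [/\ forall i, homog false (f i), forall i, homog false (g i)
      & h = \sum_i scomp (f i) (g i)].

Lemma factors_through_lsub (Y : D) : lsub (@factors_through Y).
Proof.
split.
  by exists 0, (fun _ => 0), (fun _ => 0); split=> [[]//|[]//|]; rewrite big_ord0.
move=> c _ _ [r [f [g [hf hg ->]]]] [r' [f' [g' [hf' hg' ->]]]].
exists (r + r')%N.
exists (fun i => match fintype.split i with inl j => c *: f j | inr j => f' j end).
exists (fun i => match fintype.split i with inl j => g j | inr j => g' j end).
split=> [i|i|]; try by case: fintype.split => j //; exact: homogZ.
rewrite big_split_ord scaler_sumr; congr (_ + _); apply: eq_bigr => i _ /=.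
  by rewrite (unsplitK (inl i)) (linZ (scomp_linl _)).
by rewrite (unsplitK (inr i)).
Qed.

Lemma factors_through_comp (Y : D) (f : shom X Y) (g : shom Y X) :
  homog false f -> homog false g -> factors_through (scomp f g).
Proof.
by exists 1%N, (fun _ => f), (fun _ => g); split; rewrite // big_ord1.
Qed.

(* Every object is a retract of a finite sum of copies of X. *)
Definition generator : Prop := forall Y, factors_through (sid Y).
End Factor.

(** Induction on the size of J for the d-th power of the partial sum over J: up to size d the given
    factorization is raised to the d-th power, and beyond d polarization reduces to proper subsets
    of J. *)
Lemma gamma_factors_through (k : comPzRingType) (d : nat) (C : supercat k)
    (X Y : C) (T : finType) (E : T -> shom Y Y) :
  (forall j, homog false (E j)) -> \sum_j E j = sid Y ->
  (forall J : {set T}, (#|J| <= d)%N -> exists (f : shom X Y) (g : shom Y X),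
     [/\ homog false f, homog false g & scomp f g = \sum_(j in J) E j]) ->
  @factors_through k (gammacat d C) X Y (@sid k (gammacat d C) Y).
Proof.
move=> hE E1 HJ.
have hs (I : {set T}) : homog false (\sum_(j in I) E j) by apply: homog_sum.
suff S n (J : {set T}) : (#|J| <= n)%N ->
    @factors_through k (gammacat d C) X Y (gunit d (hs J)).
  have -> : @sid k (gammacat d C) Y = gunit d (hs setT).
    by apply: gunit_irr; rewrite -E1; apply: eq_bigl => j; rewrite inE.
  exact: S (leqnn _).
elim: n J => [|n IH] J Jn.
all: have [Jd|dJ] := leqP #|J| d; [
  have [f [g [hf hg fg]]] := HJ J Jd;
  have hfg : homog false (scomp f g) by rewrite fg; exact: hs
|].
(* The small case, in the base and in the induction step: the d-th power of the composite of f and g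
   is the composite of their d-th powers. *)
all: try by rewrite -(gunit_irr d hfg _ fg) -(gunit_comp d hf hg);
  apply: factors_through_comp; exact: gunit_even.
  by move: dJ; rewrite ltnNge (leq_trans Jn).
(* The polarization identity is solved for its term at J, whose sign is its own inverse. *)
have := gunit_polarization hs dJ; rewrite (bigD1 J) //= => /eqP.
rewrite addr_eq0 => /eqP /(congr1 (fun x => (-1) ^+ #|J| *: x)).
rewrite scalerA -exprMn mulrNN mulr1 expr1n scale1r => ->.
have L := @factors_through_lsub k (gammacat d C) X Y.
apply: (lsubZ _ L); rewrite -scaleN1r; apply: (lsubZ _ L); apply: (lsub_sum _ L).
move=> I IJ; apply: (lsubZ _ L); apply: IH.
have : I \proper J by rewrite properEneq andbC.
by move=> /proper_card h; rewrite -ltnS; exact: leq_trans h Jn.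
Qed.

(** * Morita equivalence *)

(** This is the stability of finite generation and projectivity under retracts of finite powers of
    M, without forming the power: a map q from N is lifted as the sum of the h_i g_i, where h_i
    lifts q f_i. *)
Lemma in_Vk_retract (k : comPzRingType) (M N : supermod k) r
    (f : 'I_r -> homk M N) (g : 'I_r -> homk N M) :
  (forall i, homog false (f i)) -> (forall i, homog false (g i)) ->
  (forall v, v = \sum_i happ (f i) (happ (g i) v)) ->
  in_Vk M -> in_Vk N.
Proof.
move=> hf hg fg [[s [b bP]] pM]; split.
  pose T := ('I_r * 'I_s)%type.
  exists #|{: T}|, (fun i => let t := enum_val i in happ (f t.1) (b t.2)) => v.
  have /choice[c cP] i := bP (happ (g i) v).
  exists (fun i => let t := enum_val i in c t.1 t.2).
  rewrite -(reindex (@enum_val T predT) (P := predT)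
    (F := fun t => c t.1 t.2 *: happ (f t.1) (b t.2))); last exact/onW_bij/enum_val_bij.
  rewrite -(pair_bigA _ (fun i j => c i j *: happ (f i) (b j))) /= {1}(fg v).
  apply: eq_bigr => i _; rewrite {1}(cP i) (lin_sum (happ_linear (f i))).
  by apply: eq_bigr => j _; rewrite (linZ (happ_linear (f i))).
move=> P P' p q hp hq sp.
have hqf i : homog false (hcomp q (f i)).
  by exact: (@scomp_even k (smodcat k) _ _ _ false false).
have /choice[h hP] i : exists h : homk M P, homog false h /\ hcomp p h = hcomp q (f i).
  by have [h hh e] := pM _ _ p _ hp (hqf i) sp; exists h.
exists (\sum_i hcomp (h i) (g i)).
  apply: homog_sum => i _; apply: (@scomp_even k (smodcat k) _ _ _ false false) => //.
  exact: (hP i).1.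
apply: homk_ext => v.
have L : linear (fun u : homk N P => happ u v) by [].
change (happ p (happ (\sum_i hcomp (h i) (g i)) v) = happ q v).
rewrite (lin_sum L) (lin_sum (happ_linear p)) {2}(fg v) (lin_sum (happ_linear q)).
by apply: eq_bigr => i _; have /(congr1 (fun u => happ u (happ (g i) v))) := (hP i).2.
Qed.

Lemma is_equivalence_corestrict (C D : category) (F : functor C D) (P : D -> Prop)
    (FP : forall X, P (F X)) :
  (forall Y, P Y) -> is_equivalence (corestrict (F := F) (P := P) FP) -> is_equivalence F.
Proof.
(* With the membership proofs taken from [H], the image of X in the full subcategory is [J (F X)] by
   conversion. *)
move=> H; rewrite (Prop_irrelevance FP (fun X => H (F X))) => -[G [iF iG]].
pose J : functor D (fullsub P) :=
  @Functor D (fullsub P) (fun Y => exist P Y (H Y)) (fun X Y f => f)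
    (fun _ => erefl) (fun _ _ _ _ _ => erefl).
exists (compfunctor G J); split.
  by have [a [b [ba ab n]]] := iF; exists a, b; split.
have [a [b [ba ab n]]] := iG.
exists (fun Y => a (J Y)), (fun Y => b (J Y)); split=> [Y|Y|X Y f].
- exact: (ba (J Y)).
- exact: (ab (J Y)).
- exact: (n (J X) (J Y) f).
Qed.

Section Morita.
Variables (k : comPzRingType) (d : nat) (C : supercat k) (X : C).
Let D := gammacat d C.
Let S := gammaalg d (endalg X).
Hypothesis gen : @generator k D X.

(** The two sides differ only in the proof that the identity of X is even. *)
Lemma gamma_sone : sone S = @sid k D X.
Proof. exact: lval_inj. Qed.

Record frame (Y : D) := Frame {
  rk : nat;
  fr_in : 'I_rk -> @shom k D X Y;
  fr_out : 'I_rk -> @shom k D Y X;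
  fr_in_even : forall i, homog false (fr_in i);
  fr_out_even : forall i, homog false (fr_out i);
  frE : \sum_i scomp (fr_in i) (fr_out i) = sid Y }.

Arguments fr_in {Y} f i.
Arguments fr_out {Y} f i.
Arguments fr_in_even {Y} f i.
Arguments fr_out_even {Y} f i.

Lemma frame_exists (Y : D) : exists F : frame Y, True.
Proof.
by have [r [f [g [hf hg /esym e]]]] := gen Y; exists (Frame hf hg e).
Qed.
(** The inverse functor depends on one frame fixed by choice for each object. The frame chosen for X
    itself need not be the trivial one of rank one. *)
Definition fr (Y : D) : frame Y := projT1 (cid (frame_exists Y)).

(* The matrix of h over S in the chosen frames. *)
Definition coef (Y Z : D) (h : shom Y Z) (i : 'I_(rk (fr Z))) (j : 'I_(rk (fr Y))) : S :=
  @scomp k D X Z X (fr_out (fr Z) i) (@scomp k D X Y Z h (fr_in (fr Y) j)).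

Lemma coef_lin (Y Z : D) i j : linear (fun h : shom Y Z => coef h i j).
Proof.
move=> c u v; rewrite /coef.
have L1 := @scomp_linl k D X Y Z (fr_in (fr Y) j).
have L2 := @scomp_linr k D X Z X (fr_out (fr Z) i).
by rewrite (L1 c u v) (L2 c).
Qed.

Lemma coef_homog (Y Z : D) a (h : shom Y Z) i j : homog a h -> homog a (coef h i j).
Proof.
move=> hh; have := @scomp_even k D X Y Z a false h _ hh (fr_in_even (fr Y) j).
rewrite addbF => hh'.
exact: (@scomp_even k D X Z X false a _ _ (fr_out_even (fr Z) i) hh').
Qed.

(** Inserting the frame decomposition of the identity of Z turns composition into the matrix
    product. Hence the matrix of an identity is idempotent, though not always the identity
    matrix. *)
Lemma coef_comp (Y Z W : D) (h' : shom Z W) (h : shom Y Z) i j :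
  coef (scomp h' h) i j = \sum_l smul (coef h' i l) (coef h l j).
Proof.
rewrite /coef.
transitivity (@scomp k D X W X (fr_out (fr W) i) (@scomp k D X Z W h'
   (@scomp k D X Z Z (sid Z) (@scomp k D X Y Z h (fr_in (fr Y) j))))).
  by rewrite scomp1l (@scompA k D _ _ _ _ h' h).
rewrite -(frE (fr Z)) (lin_sum (scomp_linl _)) (lin_sum (scomp_linr _)).
rewrite (lin_sum (scomp_linr _)); apply: eq_bigr => l _.
rewrite -[RHS]/(@scomp k D X X X _ _).
by rewrite !scompA.
Qed.

(** * The functor attached to a module *)

Section Module.
Variable M : lsupermod S.

Section Power.
Variable r : nat.
Definition pow_par (a : bool) (w : {ffun 'I_r -> M}) : {ffun 'I_r -> M} :=
  [ffun i => par a (w i)].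
Fact pow_par_lin a : linear (pow_par a).
Proof. by move=> c u v; apply/ffunP => i; rewrite !ffunE par_lin. Qed.
Fact pow_par_par a b v : pow_par a (pow_par b v) = if a == b then pow_par b v else 0.
Proof.
by apply/ffunP => i; rewrite !ffunE par_par; case: (a == b); rewrite !ffunE.
Qed.
Fact pow_par_sum v : pow_par false v + pow_par true v = v.
Proof. by apply/ffunP => i; rewrite !ffunE par_sum. Qed.
Definition pow_super : supermod k :=
  @Supermod k {ffun 'I_r -> M} pow_par pow_par_lin pow_par_par pow_par_sum.
End Power.

Definition mapp (Y Z : D) (h : shom Y Z) (w : {ffun 'I_(rk (fr Y)) -> M}) :
    {ffun 'I_(rk (fr Z)) -> M} :=
  [ffun i => \sum_j lact (coef h i j) (w j)].

Lemma mapp_linr (Y Z : D) (h : shom Y Z) : linear (mapp h).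
Proof.
move=> c u v; apply/ffunP => i; rewrite !ffunE scaler_sumr -big_split.
by apply: eq_bigr => j _; rewrite !ffunE (lact_linr _).
Qed.

Lemma mapp_linl (Y Z : D) w : linear (fun h : shom Y Z => mapp h w).
Proof.
move=> c u v; apply/ffunP => i; rewrite !ffunE scaler_sumr -big_split.
by apply: eq_bigr => j _; rewrite coef_lin (lact_linl _).
Qed.

Lemma mapp_comp (Y Z W : D) (h' : shom Z W) (h : shom Y Z) w :
  mapp (scomp h' h) w = mapp h' (mapp h w).
Proof.
apply/ffunP => i; rewrite !ffunE.
transitivity (\sum_j \sum_l lact (coef h' i l) (lact (coef h l j) (w j))).
  apply: eq_bigr => j _; rewrite coef_comp (lin_sum (lact_linl _)).
  by apply: eq_bigr => l _; rewrite lactA.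
rewrite exchange_big; apply: eq_bigr => l _.
by rewrite ffunE (lin_sum (lact_linr _)).
Qed.

Lemma mapp_even (Y Z : D) a b (h : shom Y Z) w : homog a h ->
  homog (M := pow_super _) b w -> homog (M := pow_super _) (a (+) b) (mapp h w).
Proof.
move=> hh hw; apply/ffunP => i; rewrite !ffunE.
apply: homog_sum => j _; apply: lact_even; first exact: coef_homog.
by rewrite /homog -{2}hw ffunE.
Qed.

(** Applied to the identity of Y, this shows that the fixed columns form a graded submodule. *)
Lemma mapp_par0 (Y Z : D) a (h : shom Y Z) w : homog false h ->
  pow_par a (mapp h w) = mapp h (pow_par a w).
Proof.
move=> hh.
apply: (super_ext (M := pow_super _) (f := fun w => pow_par a (mapp h w))
  (g := fun w => mapp h (pow_par a w))) => [||b {}w hw].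
- exact: lin_comp (@pow_par_lin _ a) (mapp_linr h).
- exact: lin_comp (mapp_linr h) (@pow_par_lin _ a).
have := homogE a (mapp_even hh hw); rewrite [X in X = _ -> _]/= => ->.
have := homogE a hw; rewrite [X in X = _ -> _]/= => ->.
by rewrite addFb; case: ifP => // _; rewrite (lin0 (mapp_linr h)).
Qed.

(** The image of an idempotent matrix, which is a concrete model of the tensor product over S of the
    morphisms from X to Y with M. *)
Definition fixed (Y : D) (w : pow_super (rk (fr Y))) : Prop := mapp (sid Y) w = w.

Fact fixed_lsub Y : lsub (@fixed Y).
Proof.
split=> [|c u v hu hv]; first exact: (lin0 (mapp_linr (sid Y))).
by rewrite /fixed (mapp_linr (sid Y)) hu hv.
Qed.

Fact fixed_par Y a w : @fixed Y w -> @fixed Y (par a w).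
Proof.
by rewrite /fixed => hw; rewrite -[in RHS]hw /= (mapp_par0 _ _ (sid_even _)).
Qed.

Definition ind_ob (Y : D) : supermod k := subsuper (@fixed_lsub Y) (@fixed_par Y).

Lemma ind_homog Y a (w : ind_ob Y) :
  homog a w <-> homog (M := pow_super _) a (lval w).
Proof. by split=> [h|h]; [rewrite /homog -{2}h | exact: lval_inj]. Qed.

Lemma mapp_fixed (Y Z : D) (h : shom Y Z) w : fixed (mapp h w).
Proof. by rewrite /fixed -mapp_comp scomp1l. Qed.

Definition ind_fun (Y Z : D) (h : shom Y Z) (w : ind_ob Y) : ind_ob Z :=
  lsubm (@fixed_lsub Z) (mapp_fixed h (lval w)).

Fact ind_fun_lin (Y Z : D) (h : shom Y Z) : linear (ind_fun h).
Proof. by move=> c u v; apply: lval_inj; exact: mapp_linr. Qed.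

Definition ind_map (Y Z : D) (h : shom Y Z) : homk (ind_ob Y) (ind_ob Z) :=
  lsubm (linear_sub _ _) (@ind_fun_lin Y Z h).

Lemma ind_map_even (Y Z : D) a (h : shom Y Z) : homog a h -> homog a (ind_map h).
Proof.
move=> hh; apply: homk_homog => b w /ind_homog hw; apply/ind_homog.
exact: mapp_even.
Qed.

(* The j-th column of the idempotent matrix of the identity of Y, times m. *)
Definition ind_in (Y : D) (j : 'I_(rk (fr Y))) (m : M) : ind_ob Y :=
  lsubm (@fixed_lsub Y) (mapp_fixed (sid Y) [ffun i => if i == j then m else 0]).

Lemma ind_in_lin (Y : D) j : linear (@ind_in Y j).
Proof.
move=> c u v; apply: lval_inj => /=; rewrite -(mapp_linr (sid Y)).
congr mapp; apply/ffunP => i; rewrite !ffunE; case: eqP => // _.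
by rewrite scaler0 addr0.
Qed.

Lemma ind_out_lin (Y : D) j : linear (fun w : ind_ob Y => (lval w : {ffun _ -> M}) j).
Proof. by move=> c u v; rewrite /= !ffunE. Qed.

(** Taking the j-th coordinate and then applying [ind_in j], summed over j, multiplies by the
    idempotent matrix, which is the identity on fixed columns. So the value at Y is a retract of a
    power of M. *)
Lemma ind_ob_Vk Y : in_Vk M -> in_Vk (ind_ob Y).
Proof.
apply: (@in_Vk_retract k M (ind_ob Y) _
  (fun j => lsubm (linear_sub M (ind_ob Y)) (@ind_in_lin Y j))
  (fun j => lsubm (linear_sub (ind_ob Y) M) (@ind_out_lin Y j))).
- move=> i; apply: homk_homog => b m hm; apply/ind_homog; rewrite addFb.
  apply: (mapp_even (a := false)); first exact: sid_even.
  apply/ffunP => j; rewrite !ffunE; case: eqP => // _; exact: (lin0 (par_lin _)).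
- move=> i; apply: homk_homog => b w /ind_homog hw; rewrite addFb.
  by rewrite /homog /happ /= -{2}hw ffunE.
move=> w; apply: lval_inj.
rewrite (lin_sum (@lval_linear _ _ _ (@fixed_lsub Y))) /=.
rewrite -(lin_sum (mapp_linr (sid Y))) -[LHS](lvalPP w) /=; congr mapp.
apply/ffunP => i; rewrite sum_ffunE (bigD1 i) //= big1 => [|j /negPf ij].
  by rewrite ffunE eqxx addr0.
by rewrite ffunE eq_sym ij.
Qed.
End Module.

Definition ind (M : SmodV S) : sfunctor D (Vk k).
Proof.
refine (@Sfunctor k D (Vk k)
  (fun Y => exist _ (ind_ob (sval (sval M)) Y) (@ind_ob_Vk (sval (sval M)) Y (svalP M)))
  (@ind_map (sval (sval M))) _ _ _ _).
- move=> Y Z c u v; apply: homk_ext => w; apply: lval_inj; exact: mapp_linl.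
- move=> Y Z a h; exact: ind_map_even.
(* The identity of Y acts as the identity exactly because only fixed columns are kept. *)
- by move=> Y; apply: homk_ext => w; apply: lval_inj; exact: (lvalPP w).
- move=> W Y Z g f; apply: homk_ext => w; apply: lval_inj; exact: mapp_comp.
Defined.

(** The sign rule is trivial on an even s, so even an inhomogeneous f commutes with it. This covers
    the frame maps and the matrices of identities. *)
Lemma left_linear_even (M N : lsupermod S) (f : homk M N) s v :
  left_linear f -> homog false s -> happ f (lact s v) = lact s (happ f v).
Proof.
move=> hf hs.
have E w : happ f w = happ (par false f) w + happ (par true f) w.
  by rewrite -{1}(par_sum f).
by rewrite !E !(hf _ _ _ _ hs) /= !scale1r (linD (lact_linr s)).
Qed.

(** * Natural transformations attached to module homomorphisms *)

Section Morphisms.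
Variables (M N : lsupermod S) (f : homk M N).
Hypothesis hf : left_linear f.

Fact ind_nat_fixed Y (w : ind_ob M Y) :
  @fixed N Y [ffun i => happ f ((lval w : {ffun _ -> M}) i)].
Proof.
apply/ffunP => i; rewrite !ffunE -{2}(lvalPP w) ffunE (lin_sum (happ_linear f)).
apply: eq_bigr => j _; rewrite ffunE left_linear_even //.
exact: coef_homog (sid_even _).
Qed.

Definition ind_nat_fun Y (w : ind_ob M Y) : ind_ob N Y :=
  lsubm (@fixed_lsub N Y) (ind_nat_fixed w).

Fact ind_nat_lin Y : linear (@ind_nat_fun Y).
Proof.
move=> c u v; apply: lval_inj; apply/ffunP => i.
by rewrite !ffunE (happ_linear f).
Qed.

Definition ind_nat Y : homk (ind_ob M Y) (ind_ob N Y) :=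
  lsubm (linear_sub _ _) (@ind_nat_lin Y).

Lemma ind_nat_par e Y (w : ind_ob M Y) i :
  (lval (happ (par e (ind_nat Y)) w) : {ffun _ -> N}) i =
  happ (par e f) ((lval w : {ffun _ -> M}) i).
Proof. by rewrite /= /homk_par_fun /= !ffunE. Qed.

(** The entries of the matrix of h have the parity of h, so left linearity of f gives the required
    sign entry by entry. The two conventions put the sign on opposite sides, which agree since it
    squares to one. *)
Lemma ind_nat_signed e a (Y Z : D) (h : shom Y Z) w : homog a h ->
  ind_fun h (happ (par e (ind_nat Y)) w) =
  (-1) ^+ (e && a) *: happ (par e (ind_nat Z)) (ind_fun h w).
Proof.
move=> hh; apply: lval_inj; rewrite (linZ (@lval_linear _ _ _ (@fixed_lsub N Z))).
(* Both columns are generalized, since only the formula for their entries matters. *)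
move: (happ (par e (ind_nat Y)) w) (ind_nat_par e w) => u Eu.
move: (happ (par e (ind_nat Z)) _) (ind_nat_par e (ind_fun h w)) => v Ev.
apply/ffunP => i; rewrite [LHS]ffunE [RHS]ffunE Ev [in RHS]ffunE.
rewrite (lin_sum (happ_linear _)) scaler_sumr; apply: eq_bigr => j _.
rewrite Eu (hf _ _ (coef_homog i j hh)) scalerA -signr_addb addbb.
by rewrite scale1r.
Qed.
End Morphisms.

Fact ind_natural (M N : SmodV S) (f : hom M N) :
  @snatural k D (Vk k) (ind M) (ind N) (ind_nat (svalP f)).
Proof.
move=> e a Y Z h hh; apply: homk_ext => w.
exact: (ind_nat_signed (svalP f) e w hh).
Qed.

(** The proof [h1] is arbitrary, so that it can be the one carried by the identity morphism of the
    module category. *)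
Lemma ind_nat_id (M : lsupermod S) (h1 : left_linear (hid M)) (Y : D) :
  ind_nat h1 Y = hid (ind_ob M Y).
Proof.
by apply: homk_ext => w; apply: lval_inj; apply/ffunP => i; rewrite ffunE.
Qed.

Lemma ind_nat_comp (M N P : lsupermod S) (g : homk N P) (f : homk M N)
    (hg : left_linear g) (hf : left_linear f) (hgf : left_linear (hcomp g f)) (Y : D) :
  ind_nat hgf Y = hcomp (ind_nat hg Y) (ind_nat hf Y).
Proof.
by apply: homk_ext => w; apply: lval_inj; apply/ffunP => i; rewrite !ffunE.
Qed.

(** * Recovering a functor from its value at X *)

Section Unit.
Variable F : Pcat d C.

Definition fapp (Y Z : D) (h : shom Y Z) : sval (F Y) -> sval (F Z) :=
  happ (@sfh k D (Vk k) F Y Z h).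

Lemma fapp_linl (Y Z : D) v : linear (fun h : shom Y Z => fapp h v).
Proof. by move=> c g h; rewrite /fapp (@sfh_lin k D (Vk k) F). Qed.
Lemma fapp_linr (Y Z : D) (h : shom Y Z) : linear (fapp h).
Proof. exact: happ_linear. Qed.
Lemma fapp_comp (Y Z W : D) (g : shom Z W) (h : shom Y Z) v :
  fapp (scomp g h) v = fapp g (fapp h v).
Proof. by rewrite /fapp (@sfh_comp k D (Vk k) F). Qed.
Lemma fapp_id (Y : D) v : fapp (sid Y) v = v.
Proof. by rewrite /fapp (@sfh_id k D (Vk k) F). Qed.
Lemma fapp_even (Y Z : D) a b (h : shom Y Z) v :
  homog a h -> homog b v -> homog (a (+) b) (fapp h v).
Proof. by move=> hh hv; apply: happ_homog => //; apply: (@sfh_even k D (Vk k) F). Qed.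

Let M : lsupermod S := eval_mod X F.

Lemma fapp_frame (Y : D) v : \sum_i fapp (fr_in (fr Y) i) (fapp (fr_out (fr Y) i) v) = v.
Proof.
rewrite -[RHS]fapp_id -(frE (fr Y)) (lin_sum (fapp_linl v)).
by apply: eq_bigr => i _; rewrite fapp_comp.
Qed.

(** The column of the [fr_out] images plays the part of coordinates of v. By [fapp_frame] they
    determine v, and h acts on them through its matrix. *)
Lemma mapp_fapp (Y Z : D) (h : shom Y Z) (v : sval (F Y)) :
  mapp (M := M) h [ffun i => fapp (fr_out (fr Y) i) v] =
  [ffun i => fapp (fr_out (fr Z) i) (fapp h v)].
Proof.
apply/ffunP => i; rewrite !ffunE -{2}(fapp_frame v).
rewrite (lin_sum (fapp_linr _)) (lin_sum (fapp_linr _)).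
apply: eq_bigr => j _; rewrite ffunE.
transitivity (fapp (Y := X) (Z := X) (coef h i j) (fapp (fr_out (fr Y) j) v)); first by [].
by rewrite /coef !fapp_comp.
Qed.

Fact unit_fixed (Y : D) (v : sval (F Y)) :
  @fixed M Y [ffun i => fapp (fr_out (fr Y) i) v].
Proof. by rewrite /fixed mapp_fapp fapp_id. Qed.

Definition unit_fun (Y : D) (v : sval (F Y)) : ind_ob M Y :=
  lsubm (@fixed_lsub M Y) (unit_fixed v).
Fact unit_lin Y : linear (@unit_fun Y).
Proof.
by move=> c u v; apply: lval_inj; apply/ffunP => i; rewrite !ffunE (fapp_linr _).
Qed.
Definition unit_map Y : homk (sval (F Y)) (ind_ob M Y) :=
  lsubm (linear_sub _ _) (@unit_lin Y).

(** This recombines coordinates into a vector and is the inverse of [unit_fun]; the counit of the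
    equivalence itself is [res_map]. *)
Definition counit_fun (Y : D) (w : ind_ob M Y) : sval (F Y) :=
  \sum_i fapp (fr_in (fr Y) i) ((lval w : {ffun _ -> M}) i).
Fact counit_lin Y : linear (@counit_fun Y).
Proof.
move=> c u v; rewrite /counit_fun scaler_sumr -big_split; apply: eq_bigr => i _.
by rewrite !ffunE (fapp_linr _).
Qed.
Definition counit_map Y : homk (ind_ob M Y) (sval (F Y)) :=
  lsubm (linear_sub _ _) (@counit_lin Y).

Lemma counit_unit Y v : counit_fun (@unit_fun Y v) = v.
Proof.
by rewrite -[RHS]fapp_frame; apply: eq_bigr => i _; rewrite ffunE.
Qed.

Lemma unit_counit Y w : unit_fun (@counit_fun Y w) = w.
Proof.
apply: lval_inj; rewrite -[RHS](lvalPP w); apply/ffunP => i.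
rewrite !ffunE (lin_sum (fapp_linr _)); apply: eq_bigr => j _.
by rewrite -fapp_comp /coef scomp1l.
Qed.

Lemma unit_even Y : homog false (unit_map Y).
Proof.
apply: homk_homog => b v hv; apply/ind_homog; apply/ffunP => i; rewrite !ffunE.
exact: (fapp_even (a := false) (fr_out_even _ _) hv).
Qed.

Lemma counit_even Y : homog false (counit_map Y).
Proof.
apply: homk_homog => b w /ind_homog hw; rewrite addFb; apply: homog_sum => i _.
apply: (fapp_even (a := false)); first exact: fr_in_even.
by rewrite /homog -{2}hw ffunE.
Qed.

Lemma unit_nat (Y Z : D) (h : shom Y Z) v :
  ind_fun h (@unit_fun Y v) = unit_fun (fapp h v).
Proof. by apply: lval_inj; rewrite /= mapp_fapp. Qed.

Lemma counit_nat (Y Z : D) (h : shom Y Z) w :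
  fapp h (@counit_fun Y w) = counit_fun (ind_fun h w).
Proof. by rewrite -[LHS]counit_unit -unit_nat unit_counit. Qed.
End Unit.

(** * Recovering a module from its functor *)

Section Counit.
Variable M : lsupermod S.

Lemma sum_fr_act (m : M) :
  \sum_i lact (fr_in (fr X) i : S) (lact (fr_out (fr X) i : S) m) = m.
Proof.
rewrite -[RHS]lact1 gamma_sone -(frE (fr X)) (lin_sum (lact_linl m)).
by apply: eq_bigr => i _; rewrite -lactA.
Qed.

(** In S the entry of the matrix of s is the product g_i s f_j, and the sum of the f_j g_j is the
    unit. *)
Lemma coef_act (s : S) i (m : M) :
  \sum_j lact (coef (Y := X) (Z := X) s i j) (lact (fr_out (fr X) j : S) m) =
  lact (fr_out (fr X) i : S) (lact s m).
Proof.
rewrite -{2}(sum_fr_act m) !(lin_sum (lact_linr _)).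
apply: eq_bigr => j _; rewrite -!lactA; congr lact.
rewrite -[coef _ _ _]/(@smul k S _ (@smul k S _ _)).
by rewrite !smulA.
Qed.

(** An isomorphism is needed here, with inverse [cores_fun], because the value at X consists of
    columns in the chosen frame of X. *)
Definition res_fun (w : ind_ob M X) : M :=
  \sum_j lact (fr_in (fr X) j : S) ((lval w : {ffun _ -> M}) j).
Fact res_lin : linear res_fun.
Proof.
move=> c u v; rewrite /res_fun scaler_sumr -big_split; apply: eq_bigr => i _.
by rewrite !ffunE (lact_linr _).
Qed.
Definition res_map : homk (ind_ob M X) M := lsubm (linear_sub _ _) res_lin.

Fact cores_fixed (m : M) : @fixed M X [ffun i => lact (fr_out (fr X) i : S) m].
Proof.
apply/ffunP => i; rewrite !ffunE -[in RHS](lact1 m) gamma_sone -coef_act.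
by apply: eq_bigr => j _; rewrite ffunE.
Qed.
Definition cores_fun (m : M) : ind_ob M X := lsubm (@fixed_lsub M X) (cores_fixed m).
Fact cores_lin : linear cores_fun.
Proof.
by move=> c u v; apply: lval_inj; apply/ffunP => i; rewrite !ffunE (lact_linr _).
Qed.
Definition cores_map : homk M (ind_ob M X) := lsubm (linear_sub _ _) cores_lin.

Lemma res_cores m : res_fun (cores_fun m) = m.
Proof. by rewrite -[RHS]sum_fr_act; apply: eq_bigr => i _; rewrite ffunE. Qed.

Lemma cores_res w : cores_fun (res_fun w) = w.
Proof.
apply: lval_inj; rewrite -[RHS](lvalPP w); apply/ffunP => i.
rewrite !ffunE (lin_sum (lact_linr _)); apply: eq_bigr => j _.
by rewrite -lactA /coef scomp1l.
Qed.

Lemma cores_act (s : S) m : cores_fun (lact s m) = ind_fun (Y := X) (Z := X) s (cores_fun m).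
Proof.
apply: lval_inj; apply/ffunP => i; rewrite !ffunE -coef_act.
by apply: eq_bigr => j _; rewrite ffunE.
Qed.

Lemma res_act (s : S) w : res_fun (ind_fun (Y := X) (Z := X) s w) = lact s (res_fun w).
Proof. by rewrite -[RHS]res_cores cores_act cores_res. Qed.

Lemma cores_even : homog false cores_map.
Proof.
apply: homk_homog => b m hm; apply/ind_homog; apply/ffunP => i; rewrite !ffunE.
exact: (@lact_even k S M false b (fr_out (fr X) i) m (fr_out_even (fr X) i) hm).
Qed.

Lemma res_even : homog false res_map.
Proof.
apply: homk_homog => b w /ind_homog hw; rewrite addFb; apply: homog_sum => i _.
apply: (lact_even (a := false)); first exact: fr_in_even.
by rewrite /homog -{2}hw ffunE.
Qed.
End Counit.

Lemma snatural_even (E : supercat k) (F G : sfunctor D E) (eta : forall Y, shom (F Y) (G Y)) :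
  (forall Y, homog false (eta Y)) ->
  (forall Y Z (h : shom Y Z), scomp (sfh G h) (eta Y) = scomp (eta Z) (sfh F h)) ->
  snatural eta.
Proof.
move=> he hn e a Y Z h _; rewrite !(homogE _ (he _)); case: e => /=.
  by rewrite (lin0 (scomp_linr _)) (lin0 (scomp_linl _)) scaler0.
by rewrite scale1r hn.
Qed.

Lemma left_linear_even_map (M N : lsupermod S) (f : homk M N) :
  homog false f -> (forall s v, happ f (lact s v) = lact s (happ f v)) ->
  left_linear f.
Proof.
move=> hf hl e a s v _; rewrite !(homogE _ hf); case: e => /=.
  by rewrite (lin0 (lact_linr s)) scaler0.
by rewrite scale1r hl.
Qed.

(** The counterpart of [left_linear_even]: both homogeneous parts of n commute with an even h
    without sign. *)
Lemma snat_even (F G : Pcat d C) (n : hom F G) (Y Z : D) (h : shom Y Z) v :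
  homog false h ->
  fapp (F := G) h (happ (sval n Y) v) = happ (sval n Z) (fapp (F := F) h v).
Proof.
move=> hh.
have E W w : happ (sval n W) w = happ (par false (sval n W)) w + happ (par true (sval n W)) w.
  by rewrite -{1}(par_sum (sval n W)).
rewrite !E (linD (fapp_linr _)).
have Q e : fapp (F := G) h (happ (par e (sval n Y)) v) =
    happ (par e (sval n Z)) (fapp (F := F) h v).
  have /(congr1 (fun f => happ f v)) := svalP n e _ _ _ _ hh.
  by rewrite andbF scale1r.
by rewrite !Q.
Qed.

Definition indf : functor (SmodV S) (Pcat d C).
Proof.
refine (@Functor (SmodV S) (Pcat d C) ind (fun M N f => exist _ _ (ind_natural f)) _ _).
- move=> M; apply: eq_exist; apply: functional_extensionality_dep => Y.
  exact: (@ind_nat_id (sval (sval M)) (svalP (idm M)) Y).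
- move=> M N P g f; apply: eq_exist; apply: functional_extensionality_dep => Y.
  exact: (ind_nat_comp (svalP g) (svalP f) (svalP (comp g f)) Y).
Defined.

Theorem evalV_equivalence : is_equivalence (evalV d X : functor (Pcat d C) (SmodV S)).
Proof.
exists indf; split.
  pose G F := ind (evalV d X F).
  have Hu F : @snatural k D (Vk k) F (G F) (@unit_map F).
    apply: snatural_even => [Y|Y Z h]; first exact: unit_even.
    by apply: homk_ext => v; exact: unit_nat.
  have Hc F : @snatural k D (Vk k) (G F) F (@counit_map F).
    apply: snatural_even => [Y|Y Z h]; first exact: counit_even.
    by apply: homk_ext => v; exact: counit_nat.
  exists (fun F => exist _ _ (Hu F)), (fun F => exist _ _ (Hc F)); split.
  - move=> F; apply: eq_exist; apply: functional_extensionality_dep => Y.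
    by apply: homk_ext => v; exact: counit_unit.
  - move=> F; apply: eq_exist; apply: functional_extensionality_dep => Y.
    by apply: homk_ext => v; exact: unit_counit.
  (* Naturality in F: the components of n may be inhomogeneous, but the frame maps are even and
     commute with them. *)
  - move=> F F' n; apply: eq_exist; apply: functional_extensionality_dep => Y.
    apply: homk_ext => v; apply: lval_inj; apply/ffunP => i; rewrite !ffunE.
    by rewrite (snat_even _ _ (fr_out_even _ _)).
(* On the module side, the comparison is made at X only, where the morphism h is an element s of
   S. *)
have Hr (M : SmodV S) : @left_linear k S (eval_mod X (ind M)) (sval (sval M)) (res_map _).
  by apply: left_linear_even_map => [|s v]; [exact: res_even | exact: res_act].
have Hs (M : SmodV S) : @left_linear k S (sval (sval M)) (eval_mod X (ind M)) (cores_map _).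
  by apply: left_linear_even_map => [|s v]; [exact: cores_even | exact: cores_act].
exists (fun M => exist _ _ (Hr M)), (fun M => exist _ _ (Hs M)); split.
- by move=> M; apply: eq_exist; apply: homk_ext => v; exact: cores_res.
- by move=> M; apply: eq_exist; apply: homk_ext => v; exact: res_cores.
- move=> M N f; apply: eq_exist; apply: homk_ext => v.
  change (happ (sval f) (res_fun v) = res_fun (ind_nat_fun (svalP f) v)).
  rewrite (lin_sum (happ_linear _)); apply: eq_bigr => i _; rewrite ffunE.
  rewrite left_linear_even //; [exact: svalP f | exact: fr_in_even].
Qed.
End Morita.

(** * Generation by free supermodules *)

(* The identities of the two categories are equal, but not convertible. *)
Lemma factors_through_sfullsub (k : comPzRingType) (d : nat) (C : supercat k)
    (O : Type) (u : O -> C) (X Y : O) :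
  @factors_through k (gammacat d C) (u X) (u Y) (sid (u Y : gammacat d C)) ->
  @factors_through k (gammacat d (sfullsub u)) X Y (sid (Y : gammacat d (sfullsub u))).
Proof.
move=> [r [f [g [hf hg E]]]]; exists r, f, g; split=> //.
by apply: etrans E; exact: lval_inj.
Qed.

Section RightModuleFacts.
Variables (k : comPzRingType) (A : superalg k).

Section FreeHom.
Variables (I : finType) (s : I -> bool) (N : rsupermod A) (w : I -> N).

Definition freehom_fun (v : freemod A s) : N := \sum_i ract (w i) ((v : {ffun I -> A}) i).

Fact freehom_lin : linear freehom_fun.
Proof.
move=> c u v; rewrite /freehom_fun scaler_sumr -big_split; apply: eq_bigr => i _ /=.
by rewrite !ffunE (ract_linr (w i)).
Qed.

Fact freehom_right : @right_linear k A _ N (lsubm (linear_sub _ _) freehom_lin).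
Proof.
move=> v x; rewrite /happ /= /freehom_fun (lin_sum (ract_linl x)).
by apply: eq_bigr => i _; rewrite /free_act ffunE ractA.
Qed.

Definition freehom : homA (freemod A s) N := lsubm (@right_linear_sub _ _ _ _) freehom_right.

Lemma freehom_gen i : rapp freehom (free_gen A s i) = w i.
Proof.
rewrite /rapp /happ /= /freehom_fun (bigD1 i) //= big1 => [|j /negPf ji].
  by rewrite ffunE eqxx ract1 addr0.
by rewrite ffunE ji (lin0 (ract_linr _)).
Qed.

Lemma freehom_even : (forall i, homog (s i) (w i)) -> homog false freehom.
Proof.
move=> hw; apply/homA_homog; apply: homk_homog => b v hv; rewrite addFb.
apply: homog_sum => i _.
have hvi : homog (b (+) s i) ((v : {ffun I -> A}) i) by rewrite /homog -{2}hv ffunE.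
by have := ract_even (hw i) hvi; rewrite addbCA addbb addbF.
Qed.
End FreeHom.

Lemma rapp_linear (M N : rsupermod A) (f : homA M N) : linear (rapp f).
Proof. exact: happ_linear. Qed.

Lemma rapp_ract (M N : rsupermod A) (f : homA M N) v x :
  rapp f (ract v x) = ract (rapp f v) x.
Proof. exact: (lvalPP f). Qed.

Lemma homA_ext (M N : rsupermod A) (f g : homA M N) : rapp f =1 rapp g -> f = g.
Proof. by move=> fg; apply: lval_inj; exact: homk_ext. Qed.

Lemma freemod_ext (I : finType) (s : I -> bool) (N : rsupermod A)
    (f g : homA (freemod A s) N) :
  (forall i, rapp f (free_gen A s i) = rapp g (free_gen A s i)) -> f = g.
Proof.
move=> e; apply: homA_ext => v; rewrite (free_genE v) !(lin_sum (rapp_linear _)).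
by apply: eq_bigr => i _; rewrite !rapp_ract e.
Qed.

Lemma rapp_sum (M N : rsupermod A) (I : Type) (r : seq I) (P : pred I)
    (F : I -> homA M N) v :
  rapp (\sum_(i <- r | P i) F i) v = \sum_(i <- r | P i) rapp (F i) v.
Proof.
have L : linear (fun f : homA M N => rapp f v) by move=> c f g.
exact: (lin_sum L).
Qed.

(** A section of p writes the identity of Y as a sum of even endomorphisms, one for each generator.
    At most d of these involve only the generators in J, and t places those among the generators of
    the target free module with the same parities. *)
Lemma gamma_factors_through_free (d : nat) (I I' : finType) (s : I -> bool)
    (s' : I' -> bool) (Y : rsupermod A) (p : homA (freemod A s) Y) :
  (forall J : {set I}, (#|J| <= d)%N ->
     exists2 t : I -> I', {in J &, injective t} & {in J, forall i, s' (t i) = s i}) ->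
  rprojective Y -> homog false p -> (forall y, exists x, rapp p x = y) ->
  @factors_through k (gammacat d (rmodcat A)) (freemod A s') Y
    (@sid k (gammacat d (rmodcat A)) Y).
Proof.
move=> Ht pY hp sp.
have [q hq pq] := pY _ _ p (@sid k (rmodcat A) Y) hp (@sid_even k (rmodcat A) Y) sp.
pose y i := rapp p (free_gen A s i).
have hy i : homog (s i) (y i).
  apply: (happ_homog (a := false)); [exact/homA_homog | exact: free_gen_homog].
have cE (L M N : rsupermod A) a b (g : homA M N) (f : homA L M) :
  homog a g -> homog b f -> homog (a (+) b) (homA_comp g f).
  exact: (@scomp_even k (rmodcat A)).
(* The part of p that keeps the j-th generator only; these parts add up to p. *)
pose e j : homA (freemod A s) Y := freehom s (fun i => if i == j then y i else 0).
have he j : homog false (e j).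
  apply: freehom_even => i; case: eqP => // _; exact: homog0.
apply: (@gamma_factors_through k d (rmodcat A) _ Y I (fun j => homA_comp (e j) q)).
- by move=> j; exact: (cE _ _ _ false false).
- rewrite -(lin_sum (@scomp_linl k (rmodcat A) Y (freemod A s) Y q)) -[RHS]pq.
  congr homA_comp; apply: freemod_ext => i.
  rewrite rapp_sum (bigD1 i) //= freehom_gen eqxx big1 ?addr0 // => j /negPf ji.
  by rewrite freehom_gen eq_sym ji.
move=> J /Ht[t tinj ts].
(* On J, u moves each generator to its place under t and a brings it back to Y. The sum defining a
   has at most one term, by injectivity of t, and avoids choosing a preimage. *)
pose u : homA (freemod A s) (freemod A s') :=
  freehom s (fun i => if i \in J then free_gen A s' (t i) else 0).
pose a : homA (freemod A s') Y :=
  freehom s' (fun i' => \sum_(i in J | t i == i') y i).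
exists a, (homA_comp u q); split.
- apply: freehom_even => i'; apply: homog_sum => i /andP[iJ /eqP <-].
  by rewrite ts.
- apply: (cE _ _ _ false false) => //; apply: freehom_even => i.
  case: ifP => iJ; last exact: homog0.
  by rewrite -ts //; exact: free_gen_homog.
rewrite -(lin_sum (@scomp_linl k (rmodcat A) Y (freemod A s) Y q)).
transitivity (homA_comp (homA_comp a u) q); first exact: homA_ext.
congr homA_comp; apply: freemod_ext => i; rewrite rapp_sum.
transitivity (if i \in J then y i else 0).
  transitivity (rapp a (rapp u (free_gen A s i))) => //.
  rewrite freehom_gen; case: ifP => iJ; last exact: (lin0 (rapp_linear a)).
  rewrite freehom_gen (bigD1 i) /=; last by rewrite iJ eqxx.
  rewrite big1 ?addr0 // => j /andP[/andP[jJ /eqP tj]] /eqP[]; exact: tinj.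
rewrite (eq_bigr (fun j => if i == j then y i else 0)) => [|j _]; last by rewrite freehom_gen.
case: ifP => iJ; last first.
  by rewrite big1 // => j jJ; case: eqP => // ij; move: iJ; rewrite ij jJ.
rewrite (bigD1 i) //= eqxx big1 ?addr0 // => j /andP[_ /negPf ji].
by rewrite eq_sym ji.
Qed.

(** Elements of J have an index below the size of J, so [inord] never falls back on its default
    value. *)
Lemma inord_index_inj (I : finType) (m : nat) (J : {set I}) : (#|J| <= m.+1)%N ->
  {in J &, injective (fun i => inord (index i (enum J)) : 'I_m.+1)}.
Proof.
move=> Jm i j iJ jJ /(congr1 val) /=.
have lt l : l \in J -> (index l (enum J) < m.+1)%N.
  by move=> lJ; apply: leq_trans Jm; rewrite cardE index_mem mem_enum.
rewrite !inordK ?lt // => e.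
by rewrite -(nth_index i (s := enum J) (x := i)) ?mem_enum // e nth_index ?mem_enum.
Qed.

(** Each generator is replaced by its even and odd parts, and both receive the coefficient of the
    original. *)
Lemma super_generated (Y : rsupermod A) : rfg Y ->
  exists r (p : homA (freemod A (fun t : 'I_r * bool => t.2)) Y),
    homog false p /\ forall y, exists x, rapp p x = y.
Proof.
move=> [r [g gP]]; exists r, (freehom _ (fun t => par t.2 (g t.1))); split.
  by apply: freehom_even => t; exact: par_homog.
move=> y; have [c yE] := gP y; pose x : {ffun 'I_r * bool -> A} := [ffun t => c t.1].
exists x.
transitivity (\sum_(t : 'I_r * bool) ract (par t.2 (g t.1)) (c t.1)).
  by apply: eq_bigr => t _; rewrite ffunE.
transitivity (\sum_(t : 'I_r * bool) ract (par t.2 (g t.1)) (c t.1)).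
  apply: eq_bigr => t _; congr ract; exact: ffunE.
rewrite yE -(pair_bigA _ (fun i b => ract (par b (g i)) (c i))) /=.
apply: eq_bigr => i _; rewrite big_bool /= -(linD (ract_linl _)) addrC.
by rewrite par_sum.
Qed.

Lemma VA_generator (m n d : nat) : (0 < m)%N -> (0 < n)%N -> (d <= m)%N -> (d <= n)%N ->
  @generator k (gammacat d (VA A)) (AsuperV A m n).
Proof.
case: m => // m; case: n => // n _ _ dm dn [Y [fY pY]].
have [r [p [hp sp]]] := super_generated fY.
apply: factors_through_sfullsub.
apply: (gamma_factors_through_free (p := p)) => // J Jd.
(* The odd generators go to the shifted copies of A and the even ones to the others. Both are
   numbered by their rank in the whole of J, so at most d places of each kind are used. *)
exists (fun t => if t.2 then inr (inord (index t (enum J)))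
                  else inl (inord (index t (enum J)))).
  move=> [i a] [j b] iJ jJ; case: a iJ; case: b jJ => //= jJ iJ [].
    exact: inord_index_inj (leq_trans Jd dn) _ _ iJ jJ.
  exact: inord_index_inj (leq_trans Jd dm) _ _ iJ jJ.
by move=> t _; case: t.2.
Qed.

Lemma EA_generator (n d : nat) : (0 < n)%N -> (d <= n)%N ->
  @generator k (gammacat d (EA A)) (AevenE A n).
Proof.
case: n => // n _ dn [[Y [fY pY]] [r [p [hp sp]]]].
(* [EA] is a full subcategory of [VA], itself one of all right supermodules. *)
apply: factors_through_sfullsub; apply: factors_through_sfullsub.
apply: (gamma_factors_through_free (p := p)) => // J Jd.
exists (fun i => inord (index i (enum J))) => //.
exact: inord_index_inj (leq_trans Jd dn).
Qed.
End RightModuleFacts.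

(** * Modules over a field *)

Section Spans.
Variable k : comPzRingType.

Definition spanned (V : lmodType k) (T : finType) (g : T -> V) (v : V) : Prop :=
  exists c : T -> k, v = \sum_t c t *: g t.

Lemma spanned_lsub (V : lmodType k) (T : finType) (g : T -> V) : lsub (spanned g).
Proof.
split; first by exists (fun _ => 0); rewrite big1 // => t _; rewrite scale0r.
move=> c _ _ [a ->] [b ->]; exists (fun t => c * a t + b t).
rewrite scaler_sumr -big_split; apply: eq_bigr => t _.
by rewrite scalerDl scalerA.
Qed.

Lemma spanned_gen (V : lmodType k) (T : finType) (g : T -> V) t : spanned g (g t).
Proof.
exists (fun u => if u == t then 1 else 0).
rewrite (bigD1 t) //= eqxx scale1r big1 ?addr0 // => u /negPf ->.
by rewrite scale0r.
Qed.

Lemma kfg_spanned (V : lmodType k) (T : finType) (g : T -> V) :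
  (forall v, spanned g v) -> kfg V.
Proof.
move=> gP; exists #|T|, (fun i => g (enum_val i)) => v; have [c ->] := gP v.
exists (fun i => c (enum_val i)).
by rewrite (reindex (@enum_val T predT)) //; exact/onW_bij/enum_val_bij.
Qed.

Lemma kfg_ffun (T : finType) (V : lmodType k) : kfg V -> kfg {ffun T -> V}.
Proof.
move=> [r [g gP]].
pose b (t : T * 'I_r) : {ffun T -> V} := [ffun i => if i == t.1 then g t.2 else 0].
apply: (kfg_spanned (g := b)) => v.
have -> : v = \sum_i [ffun j => if j == i then v i else 0].
  apply/ffunP => i; rewrite sum_ffunE (bigD1 i) //= ffunE eqxx big1 ?addr0 // => j /negPf ji.
  by rewrite ffunE eq_sym ji.
apply: (lsub_sum _ (spanned_lsub b)) => i _; have [c ->] := gP (v i).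
have -> : [ffun j => if j == i then \sum_l c l *: g l else 0] = \sum_l c l *: b (i, l).
  apply/ffunP => j; rewrite sum_ffunE ffunE.
  case: ifP => ji; last by rewrite big1 // => l _; rewrite !ffunE /= ji scaler0.
  by apply: eq_bigr => l _; rewrite !ffunE /= ji.
by apply: (lsub_sum _ (spanned_lsub b)) => l _;
  apply: lsubZ (spanned_lsub b) (spanned_gen _ _).
Qed.

(** The pure tensors of generators suffice: the entries of a pure tensor are expanded one at a time,
    l listing those not yet known to be generators. *)
Lemma kfg_tpow (d : nat) (M : lmodType k) : kfg M -> kfg (tpow d M).
Proof.
move=> [r [g gP]].
pose b (t : {ffun 'I_d -> 'I_r}) : tpow d M := pure [ffun i => g (t i)].
have L := spanned_lsub b.
suff S (l : seq 'I_d) : forall v : {ffun 'I_d -> M},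
    (forall i, i \in l \/ exists j, v i = g j) -> spanned b (pure v).
  apply: (kfg_spanned (g := b)) => x; rewrite (pure_span x).
  apply: (lsub_sum _ L) => p _; apply: (lsubZ _ L).
  by apply: (S (enum 'I_d)) => i; left; rewrite mem_enum.
elim: l => [|i l IH] v hv.
  have /choice[t ht] i : exists j, v i = g j by case: (hv i).
  have -> : pure v = b [ffun i => t i].
    by congr pure; apply/ffunP => i; rewrite !ffunE.
  exact: spanned_gen.
have [c vi] := gP (v i).
rewrite -(tupd_id v i) vi (lin_sum (pure_multilinear v i)).
apply: (lsub_sum _ L) => j _; rewrite (linZ (pure_multilinear v i)); apply: (lsubZ _ L).
apply: IH => j'; rewrite ffunE; case: eqP => [_|/eqP ne]; first by right; exists j.
by case: (hv j'); [rewrite inE (negPf ne); left | right].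
Qed.

(** The linear span, written so that the generators can be eliminated one by one. *)
Fixpoint kspan (V : lmodType k) (l : seq V) (v : V) : Prop :=
  if l is g :: l' then exists c, kspan l' (v - c *: g) else v = 0.

Lemma kspan_lsub (V : lmodType k) (l : seq V) : lsub (kspan l).
Proof.
elim: l => [|g l [IH0 IHD]] /=; split=> //.
- by move=> c u v -> ->; rewrite scaler0 addr0.
- by exists 0; rewrite scale0r subr0.
move=> c u v [a ha] [b hb]; exists (c * a + b).
have -> : c *: u + v - (c * a + b) *: g = c *: (u - a *: g) + (v - b *: g).
  by rewrite scalerBr scalerA scalerDl opprD addrACA.
exact: IHD.
Qed.

Lemma kfgP (V : lmodType k) : kfg V <-> exists l : seq V, forall v, kspan l v.
Proof.
split=> [[r [g gP]]|[l lP]].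
  exists [seq g i | i <- enum 'I_r] => v; have [c ->] := gP v.
  rewrite -big_enum /=; elim: (enum 'I_r) => [|i s IH]; first by rewrite big_nil.
  by exists (c i); rewrite big_cons addrAC subrr add0r.
exists (size l), (fun i => l`_i) => v; elim: l v {lP} (lP v) => [|g l IH] v /=.
  by move=> ->; exists (fun _ => 0); rewrite big_ord0.
move=> [a /IH[c hc]].
exists (fun i => if unlift ord0 i is Some j then c j else a).
rewrite big_ord_recl unlift_none /=.
under eq_bigr => i _ do rewrite liftK.
by rewrite -hc addrC subrK.
Qed.
End Spans.

Section Field.
Variable k : comPzRingType.
Hypothesis fk : is_field k.

(** Gaussian elimination along a list that spans W. *)
Lemma kfg_inj (V W : lmodType k) (f : V -> W) :
  linear f -> injective f -> kfg W -> kfg V.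
Proof.
move=> lf injf /kfgP[l lP]; apply/kfgP.
(* The statement is generalized to submodules P, as each elimination step passes to the vectors
   whose images avoid one more generator. *)
suff S (P : V -> Prop) : lsub P -> (forall v, P v -> kspan l (f v)) ->
    exists l' : seq V, forall v, P v -> kspan l' v.
  have [|//|l' l'P] := S (fun _ => True); first by split.
  by exists l' => v; exact: l'P.
elim: l P {lP} => [|g l IH] P LP hP.
  by exists [::] => v /hP fv; apply: injf; rewrite (lin0 lf).
(* The vector w is a pivot for g. Without a pivot, the rest of the list already spans the image of
   P. *)
have [[w [Pw [c [c0 hw]]]]|N] :=
  pselect (exists w, P w /\ exists c, c <> 0 /\ kspan l (f w - c *: g)); last first.
  apply: IH LP _ => v Pv; have [c hc] := hP v Pv.
  have [c0|c0] := pselect (c = 0); first by move: hc; rewrite c0 scale0r subr0.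
  by case: N; exists v; split=> //; exists c.
have [b cb] := fk.2 c c0.
have [||l' l'P] := IH (fun v => P v /\ kspan l (f v)).
- split; first by split; [exact: LP.1 | rewrite (lin0 lf); exact: (kspan_lsub l).1].
  move=> a u v [Pu hu] [Pv hv]; split; first exact: LP.2.
  by rewrite lf; exact: (kspan_lsub l).2.
- by move=> v [].
(* The multiple of w that cancels the coefficient a of g is a times the inverse b of c. *)
exists (w :: l') => v Pv; have [a ha] := hP v Pv; exists (a * b); apply: l'P.
have E : v - (a * b) *: w = - (a * b) *: w + v by rewrite scaleNr addrC.
rewrite E; split; first exact: LP.2.
rewrite lf.
have -> : - (a * b) *: f w + f v = - (a * b) *: (f w - c *: g) + (f v - a *: g).
  rewrite scalerBr scalerA addrACA mulNr -mulrA [b * c]mulrC cb mulr1 [(- a) *: g]scaleNr opprK.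
  by rewrite subrr addr0.
exact: (kspan_lsub l).2.
Qed.

Lemma homog_generators (M : supermod k) : kfg M ->
  exists n (g : 'I_n -> M), (forall i, exists a, homog a (g i)) /\ forall v, spanned g v.
Proof.
move=> [r [g gP]]; pose T := ('I_r * bool)%type.
exists #|{: T}|, (fun i => let t : T := enum_val i in par t.2 (g t.1)).
split=> [i|v]; first by eexists; exact: par_homog.
have [c ->] := gP v; exists (fun i => let t : T := enum_val i in c t.1).
rewrite -(reindex (@enum_val T predT) (P := predT)
    (F := fun t => c t.1 *: par t.2 (g t.1))); last exact/onW_bij/enum_val_bij.
rewrite -(pair_bigA _ (fun i a => c i *: par a (g i))) /=.
apply: eq_bigr => i _; rewrite big_bool /= -scalerDr addrC.
by rewrite par_sum.
Qed.

(** A system of homogeneous generators of minimal size is independent, since a nontrivial relation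
    would express one of them through the others. *)
Lemma homog_basis (M : supermod k) : kfg M ->
  exists n (g : 'I_n -> M), [/\ forall i, exists a, homog a (g i),
    forall v, spanned g v
    & forall c : 'I_n -> k, \sum_i c i *: g i = 0 -> forall i, c i = 0].
Proof.
move=> /homog_generators[n0 gens0].
pose Q n := exists g : 'I_n -> M, (forall i, exists a, homog a (g i)) /\ forall v, spanned g v.
have [n /asboolP[g [hg gP]] nmin] :=
  ex_minnP (ex_intro (fun n => `[< Q n >]) n0 (introT (asboolP _) gens0)).
exists n, g; split=> // c gc0 i; apply: contrapT => ci0.
have [b cb] := fk.2 _ ci0.
case: n g hg gP nmin c gc0 i ci0 cb => [|n] g hg gP nmin c gc0 i ci0 cb;
  first by case: i {ci0 cb}.
suff /nmin : `[< Q n >] by rewrite ltnn.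
pose g' j := g (lift i j).
have gi : spanned g' (g i).
  (* The relation is divided by its nonzero coefficient at i and solved for g_i. *)
  exists (fun j => - (b * c (lift i j))).
  have := congr1 (fun v => b *: v) gc0; rewrite scaler0 (bigD1_ord i) //= scalerDr scalerA.
  rewrite [b * _]mulrC cb scale1r => /eqP; rewrite addr_eq0 => /eqP ->.
  by rewrite scaler_sumr -sumrN; apply: eq_bigr => j _; rewrite scalerA scaleNr.
apply/asboolP; exists g'; split=> [j|v]; first exact: hg.
have L := spanned_lsub g'.
have [a ->] := gP v; rewrite (bigD1_ord i) //=; rewrite -[X in _ + X]scale1r addrC.
have := L.2 1 _ _ (lsubZ (a i) L gi) => F; rewrite addrC [X in _ + X]scale1r.
rewrite -[a i *: _]scale1r; apply: F.
apply: (lsub_sum _ L) => j _; apply: (lsubZ _ L); exact: spanned_gen g' j.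
Qed.

(** Homogeneous basis vectors can be lifted with their own parities, and extending linearly gives an
    even lift. *)
Lemma field_in_Vk (M : supermod k) : kfg M -> in_Vk M.
Proof.
move=> fM; split=> // N N' p q hp hq sp.
have [n [g [/choice[s hs] gP ind]]] := homog_basis fM.
have uniq (a b : 'I_n -> k) : \sum_i a i *: g i = \sum_i b i *: g i -> a =1 b.
  move=> /eqP; rewrite -subr_eq0 -sumrB => /eqP e i; apply/eqP; rewrite -subr_eq0.
  apply/eqP; apply: (ind (fun i => a i - b i)); rewrite -[RHS]e.
  by apply: eq_bigr => j _; rewrite scalerBl.
have /choice[c cP] v : exists c : 'I_n -> k, v = \sum_i c i *: g i := gP v.
have /choice[w hw] i : exists w : N, homog (s i) w /\ happ p w = happ q (g i).
  have [x px] := sp (happ q (g i)); exists (par (s i) x); split; first exact: par_homog.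
  by rewrite -(happ_even _ _ hp) px (happ_even _ _ hq) hs.
have cD a u v : c (a *: u + v) =1 (fun i => a * c u i + c v i).
  apply: uniq; rewrite -cP {1}(cP u) {1}(cP v) scaler_sumr -big_split.
  by apply: eq_bigr => i _; rewrite scalerDl scalerA.
pose h v : N := \sum_i c v i *: w i.
have lh : linear h.
  move=> a u v; rewrite /h scaler_sumr -big_split; apply: eq_bigr => i _.
  by rewrite cD scalerDl scalerA.
exists (lsubm (linear_sub _ _) lh).
  apply: homk_homog => b v hv; rewrite addFb; apply: homog_sum => i _.
  (* By uniqueness of coordinates, a vector of parity b involves only basis vectors of parity b. *)
  have -> : c v i = if s i == b then c v i else 0.
    apply: (uniq (c v) (fun i => if s i == b then c v i else 0)).
    rewrite -cP -{1}hv {1}(cP v) (lin_sum (par_lin b)); apply: eq_bigr => j _.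
    rewrite (linZ (par_lin b)) (homogE b (hs j)) eq_sym.
    by case: eqP; rewrite ?scaler0 ?scale0r.
  case: eqP => [<-|_]; first exact: homogZ (hw i).1.
  rewrite scale0r; exact: homog0.
apply: homk_ext => v; change (happ p (h v) = happ q v).
rewrite {2}(cP v) !(lin_sum (happ_linear _)); apply: eq_bigr => i _.
by rewrite !(linZ (happ_linear _)) (hw i).2.
Qed.

Lemma kfg_divpow d (M : supermod k) : kfg M -> kfg (divpow d M).
Proof.
move=> /(kfg_tpow d); apply: kfg_inj (@lval_linear _ _ _ (@tinv_sub k d M)) _.
exact: lval_inj.
Qed.

(** A homomorphism is determined by its values on k-generators of M, so these maps embed in a finite
    power of N. *)
Lemma kfg_homA (A : superalg k) (M N : rsupermod A) : kfg M -> kfg N -> kfg (homA M N).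
Proof.
move=> [r [g gP]] /(kfg_ffun 'I_r).
apply: (@kfg_inj _ _ (fun f : homA M N => [ffun i => rapp f (g i)])).
  by move=> c u v; apply/ffunP => i; rewrite !ffunE.
move=> u v /ffunP e; apply: lval_inj; apply: homk_ext => x.
have [c ->] := gP x; rewrite !(lin_sum (happ_linear _)); apply: eq_bigr => i _.
by rewrite !(linZ (happ_linear _)); have := e i; rewrite !ffunE /rapp => ->.
Qed.

Lemma kfg_lfg (S : superalg k) (M : lsupermod S) : kfg S -> lfg M -> kfg M.
Proof.
move=> [r [b bP]] [s [g gP]].
apply: (kfg_spanned (g := fun t : 'I_r * 'I_s => lact (b t.1) (g t.2))) => v.
have L := spanned_lsub (fun t : 'I_r * 'I_s => lact (b t.1) (g t.2)).
have [c ->] := gP v; apply: (lsub_sum _ L) => i _; have [a ->] := bP (c i).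
rewrite (lin_sum (lact_linl _)); apply: (lsub_sum _ L) => j _.
rewrite (linZ (lact_linl _)); apply: (lsubZ _ L).
exact: spanned_gen (fun t : 'I_r * 'I_s => lact (b t.1) (g t.2)) (j, i).
Qed.

(** The Schur superalgebra is finite dimensional, hence so are its finitely generated modules; this
    makes the condition defining [SmodV] automatic over a field. *)
Lemma gamma_end_in_Vk (A : superalg k) (I : finType) (s : I -> bool) (d : nat)
    (M : lsupermod (gammaalg d (@endalg k (rmodcat A) (freemod A s)))) :
  fgfree A -> lfg M -> in_Vk M.
Proof.
move=> [r [b bP]] fM; apply: field_in_Vk; apply: kfg_lfg fM.
have kA : kfg A by exists r, b => v; have [c [-> _]] := bP v; exists c.
by apply: kfg_divpow; apply: kfg_homA; exact: kfg_ffun.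
Qed.
End Field.

Theorem theorem4p3 (k : comPzRingType) (A : superalg k) (m n d : nat)
    (hA : fgfree A) (m_gt0 : (0 < m)%N) (n_gt0 : (0 < n)%N) (d_gt0 : (0 < d)%N)
    (le_dm : (d <= m)%N) (le_dn : (d <= n)%N) :
  [/\ is_equivalence
        (evalV d (AsuperV A m n)
           : functor (Pcat d (VA A)) (SmodV (schur A m n d))),
      is_equivalence
        (evalV d (AevenE A n)
           : functor (Pcat d (EA A)) (SmodV (schur_even A n d))),
      is_field k ->
      is_equivalence
        (eval d (AsuperV A m n)
           : functor (Pcat d (VA A)) (Smod (schur A m n d)))
    & is_field k ->
      is_equivalence
        (eval d (AevenE A n)
           : functor (Pcat d (EA A)) (Smod (schur_even A n d)))].
Proof.
split=> [||fk|fk].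
- exact (evalV_equivalence (VA_generator (A := A) m_gt0 n_gt0 le_dm le_dn)).
- exact (evalV_equivalence (EA_generator (A := A) n_gt0 le_dn)).
(* Over a field every object of [Smod] satisfies the condition of [SmodV], so the equivalence
   transfers. *)
- apply: (is_equivalence_corestrict _
    (evalV_equivalence (VA_generator (A := A) m_gt0 n_gt0 le_dm le_dn))).
  by move=> M; exact: (gamma_end_in_Vk fk hA (svalP M)).
- apply: (is_equivalence_corestrict _ (evalV_equivalence (EA_generator (A := A) n_gt0 le_dn))).
  by move=> M; exact: (gamma_end_in_Vk fk hA (svalP M)).
Qed.
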